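(* Let $X$ be the pseudoarc and let $\mathrm{Homeo}(X)$ be the group of all homeomorphisms of $X$ onto itself, with the compact-open topology (equivalently, the topology of uniform convergence with respect to any compatible metric on $X$). Then $\mathrm{Homeo}(X)$ has a dense conjugacy class, i.e. there is $\phi\in\mathrm{Homeo}(X)$ such that $\{\theta^{-1}\circ\phi\circ\theta:\theta\in\mathrm{Homeo}(X)\}$ is dense in $\mathrm{Homeo}(X)$.
   Context: A continuum is a connected metrisable compact space. A continuum is indecomposable if it is not the union of two proper subcontinua, and hereditarily indecomposable if all of its subcontinua are indecomposable; equivalently, for all subcontinua $Y,Z$ with $Y\cap Z\neq\emptyset$, either $Y\subseteq Z$ or $Z\subseteq Y$. A continuum is chainable if every open cover is refined by a chain, i.e. by a finite open cover which forms a path graph with respect to the overlap relation $O\cap N\neq\emptyset$ (its members can be enumerated as $O_0,\ldots,O_n$ so that $O_j\cap O_k\neq\emptyset$ if and only if $|j-k|\leq1$). A pseudoarc is a chainable hereditarily indecomposable continuum with more than one point. Pseudoarcs exist and any two of them are homeomorphic, so one speaks of ''the'' pseudoarc. *)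

(* Defs.v *)
From HB Require Import structures.
From mathcomp Require Import all_boot all_order all_algebra.
From mathcomp Require Import all_classical all_reals topology.

Set Implicit Arguments.
Unset Strict Implicit.
Unset Printing Implicit Defensive.

Import Order.TTheory GRing.Theory Num.Theory.

Local Open Scope classical_set_scope.

Section Continua.
Local Open Scope ring_scope.

Definition metrizable (R : realType) (X : topologicalType) :=
  exists d : X -> X -> R,
    [/\ forall x y, d x y = 0 <-> x = y,
        forall x y, d x y = d y x,
        forall x y z, d x z <= d x y + d y z &
        forall x (A : set X),
          nbhs x A <-> exists2 e : R, 0 < e & [set y | d x y < e] `<=` A].

Definition continuum (R : realType) (X : topologicalType) :=
  [/\ connected [set: X], compact [set: X] & metrizable R X].

(* Metrizability passes to subspaces, so it is not repeated here;
   see [subcontinuumE]. *)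
Definition subcontinuum (X : topologicalType) (Y : set X) :=
  connected Y /\ compact Y.

Definition indecomposable (X : topologicalType) (Y : set X) :=
  ~ exists A B : set X,
      [/\ subcontinuum A, subcontinuum B, A `<` Y, B `<` Y & Y = A `|` B].

Definition hereditarily_indecomposable (X : topologicalType) :=
  forall Y : set X, subcontinuum Y -> indecomposable Y.

(* The condition on [j] and [k] is |j - k| <= 1. *)
Definition chain (X : topologicalType) (n : nat) (O : 'I_n.+1 -> set X) :=
  [/\ forall j, open (O j),
      \bigcup_j O j = [set: X] &
      forall j k : 'I_n.+1,
        (O j `&` O k !=set0) <-> (j <= k.+1)%N /\ (k <= j.+1)%N].

Definition refines (X : Type) (I : Type) (O : I -> set X) (C : set (set X)) :=
  forall i, exists2 U, C U & O i `<=` U.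

Definition chainable (X : topologicalType) :=
  forall C : set (set X),
    (forall U, C U -> open U) -> \bigcup_(U in C) U = [set: X] ->
    exists n (O : 'I_n.+1 -> set X), chain O /\ refines O C.

Definition pseudoarc (R : realType) (X : topologicalType) :=
  [/\ continuum R X, chainable X, hereditarily_indecomposable X &
      exists x y : X, x <> y].

End Continua.

Section SubspaceFacts.
Local Open Scope ring_scope.

Lemma open_set_typeP (X : topologicalType) (Y : set X) (B : set Y) :
  open B <-> exists2 C : set X, open C & B = set_val @^-1` C.
Proof. by split=> -[C oC] BC; exists C. Qed.

Lemma closed_set_typeP (X : topologicalType) (Y : set X) (B : set Y) :
  closed B <-> exists2 C : set X, closed C & B = set_val @^-1` C.
Proof.
split=> [|[C cC ->]].
  rewrite -openC => /open_set_typeP[C oC BC]; exists (~` C).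
    exact: open_closedC.
  by rewrite -preimage_setC -BC setCK.
by rewrite -openC; apply/open_set_typeP; exists (~` C) => //; exact: closed_openC.
Qed.

Lemma set_val_continuous (X : topologicalType) (Y : set X) :
  continuous (set_val : Y -> X).
Proof. exact: initial_continuous. Qed.

Lemma range_set_val (X : Type) (Y : set X) : range (set_val : Y -> X) = Y.
Proof.
apply/seteqP; split=> [_ [y _ <-]|x Yx]; first exact: set_valP.
by exists (exist _ x (mem_set Yx)).
Qed.

Lemma metrizable_set_type (R : realType) (X : topologicalType) (Y : set X) :
  metrizable R X -> metrizable R Y.
Proof.
case=> d [d0 dC dT dN]; exists (fun x y => d (set_val x) (set_val y)); split.
- move=> x y; rewrite d0; split=> [|->//].
  by move=> /val_inj.
- by move=> x y; exact: dC.
- by move=> x y z; exact: dT.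
move=> x A; split.
  rewrite nbhsE => -[B [/open_set_typeP[C oC ->] Cx] CA].
  have /dN[e e0 eC] : nbhs (set_val x) C by apply: open_nbhs_nbhs.
  by exists e => // y /eC ?; exact: CA.
case=> e e0 eA.
have dx : nbhs (set_val x) [set y | d (set_val x) y < e].
  by apply/dN; exists e.
exact: (filterS eA (set_val_continuous dx)).
Qed.

Lemma subcontinuumE (R : realType) (X : topologicalType) (Y : set X) :
  metrizable R X -> subcontinuum Y <-> continuum R Y.
Proof.
move=> mX; split=> [[cY kY]|[cY kY _]]; last first.
  split; rewrite -{1}(range_set_val Y).
    apply: connected_continuous_connected => //.
    exact/continuous_subspaceT/set_val_continuous.
  apply: continuous_compact => //.
  exact/continuous_subspaceT/set_val_continuous.
split; last exact: metrizable_set_type.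
- move=> B B0 [C1 + BC1] [C2 + BC2]; rewrite !setTI in BC1 BC2; subst C1 C2.
  move=> /open_set_typeP[C oC BC] /closed_set_typeP[D cD BD].
  have YB : Y `&` C = Y.
    apply: cY; [|by exists C|exists D => //].
    - case: B0 => b; rewrite BC => Cb; exists (set_val b); split=> //.
      exact: set_valP.
    - apply/seteqP; split=> x [Yx]; pose x' : Y := exist _ x (mem_set Yx).
        move=> Cx; split=> //; suff : B x' by rewrite BD.
        by rewrite BC.
      move=> Dx; split=> //; suff : B x' by rewrite BC.
      by rewrite BD.
  rewrite BC; apply/seteqP; split=> // y _ /=.
  have : Y (set_val y) by exact: set_valP.
  by rewrite -{1}YB => -[].
move=> F FF _.
have [|p [Yp cp]] := kY ((set_val : Y -> X) @ F) (fmap_proper_filter _ FF).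
  by apply: (@filterS _ F _ setT) filterT => y _; exact: set_valP.
exists (exist _ p (mem_set Yp)); split=> // A B FA.
rewrite nbhsE => -[_ [/open_set_typeP[C oC ->] Cp] CB].
have [] := cp (set_val @` A) C.
- by apply: (@filterS _ F _ A) FA => y Ay; exists y.
- exact: open_nbhs_nbhs.
by move=> _ [[y Ay <-] Cy]; exists y; split=> //; exact: CB.
Qed.

End SubspaceFacts.

Definition homeomorphism (X Y : topologicalType) (f : X -> Y) :=
  continuous f /\
  exists g : Y -> X, [/\ continuous g, cancel f g & cancel g f].

Definition homeomorphisms (X : topologicalType) : set {compact-open, X -> X} :=
  [set f | @homeomorphism X X f].

(* The topology on [Homeo X] is the one induced by the compact-open topology. *)
Definition Homeo (X : topologicalType) : Type := set_type (@homeomorphisms X).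

HB.instance Definition _ (X : topologicalType) :=
  Topological.copy (Homeo X) (set_type (@homeomorphisms X)).

Section HomeoGroup.
Variable X : topologicalType.

Definition homeo_fun (f : Homeo X) : X -> X := set_val f.

Coercion homeo_fun : Homeo >-> Funclass.

Lemma homeoP (f : Homeo X) : homeomorphism f.
Proof. exact: (set_valP f). Qed.

Lemma homeo_ext (f g : Homeo X) : f =1 g -> f = g.
Proof. by move=> fg; apply: val_inj; exact/funext/fg. Qed.

Definition mk_homeo (f : X -> X) (hf : homeomorphism f) : Homeo X :=
  exist _ (f : {compact-open, X -> X}) (mem_set hf).

Lemma homeomorphism_id : homeomorphism (@id X).
Proof.
have cid : continuous (@id X) by move=> x; exact: cvg_id.
by split=> //; exists id; split.
Qed.

Lemma homeomorphism_comp (f g : Homeo X) : homeomorphism (f \o g).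
Proof.
have [cf [f' [cf' ff' f'f]]] := homeoP f.
have [cg [g' [cg' gg' g'g]]] := homeoP g.
split; first by move=> x; apply: continuous_comp; [exact: cg|exact: cf].
exists (g' \o f'); split; last 2 first.
- exact: can_comp.
- exact: can_comp.
by move=> x; apply: continuous_comp; [exact: cf'|exact: cg'].
Qed.

Definition homeo_inv_fun (f : Homeo X) : X -> X := sval (cid (homeoP f).2).

Lemma homeo_inv_funP (f : Homeo X) :
  [/\ continuous (homeo_inv_fun f), cancel f (homeo_inv_fun f) &
      cancel (homeo_inv_fun f) f].
Proof. exact: svalP (cid (homeoP f).2). Qed.

Lemma homeomorphism_inv (f : Homeo X) : homeomorphism (homeo_inv_fun f).
Proof.
have [cg fg gf] := homeo_inv_funP f.
by split=> //; exists f; split=> //; have [] := homeoP f.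
Qed.

Definition homeo_one : Homeo X := mk_homeo homeomorphism_id.
Definition homeo_mul (f g : Homeo X) : Homeo X :=
  mk_homeo (homeomorphism_comp f g).
Definition homeo_inv (f : Homeo X) : Homeo X := mk_homeo (homeomorphism_inv f).

Lemma homeo_mulA : associative homeo_mul.
Proof. by move=> f g h; exact: homeo_ext. Qed.

Lemma homeo_mul1 : left_id homeo_one homeo_mul.
Proof. by move=> f; exact: homeo_ext. Qed.

Lemma homeo_mulr1 : right_id homeo_one homeo_mul.
Proof. by move=> f; exact: homeo_ext. Qed.

Lemma homeo_mulV : left_inverse homeo_one homeo_inv homeo_mul.
Proof.
by move=> f; apply: homeo_ext => x; have [_ + _] := homeo_inv_funP f; exact.
Qed.

Lemma homeo_mulrV : right_inverse homeo_one homeo_inv homeo_mul.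
Proof.
by move=> f; apply: homeo_ext => x; have [_ _ +] := homeo_inv_funP f; exact.
Qed.

End HomeoGroup.

HB.instance Definition _ (X : topologicalType) :=
  isGroup.Build (Homeo X) (@homeo_mulA X) (@homeo_mul1 X) (@homeo_mulr1 X)
    (@homeo_mulV X) (@homeo_mulrV X).

Lemma homeoM (X : topologicalType) (f g : Homeo X) (x : X) :
  ((f * g)%g : Homeo X) x = f (g x).
Proof. by []. Qed.

Lemma homeoV (X : topologicalType) (f : Homeo X) : cancel f ((f^-1)%g : Homeo X).
Proof. by have [] := homeo_inv_funP f. Qed.

Definition conjugacy_class (G : groupType) (phi : G) : set G :=
  [set (theta^-1 * phi * theta)%g | theta in [set: G]].

(* Main.v *)
(* On a hereditarily indecomposable continuum two intersecting subcontinua are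
   nested.  Applied to components of sub- and superlevel sets this shows that a
   map onto an interval lifts, up to a small error, over every fold of the
   interval, hence over every zigzag, a zigzag being a composition of folds (its
   shortest piece can be folded away).  A back-and-forth argument with finer and
   finer zigzags then gives approximate homogeneity: any two maps u, v of the
   pseudoarc onto the same interval satisfy |u - v o h| <= eta for some
   homeomorphism h.

   A homeomorphism f has a fixed point x, and since the components of x in the
   sets {a <= w <= b} are nested, x is an end point: there are maps w onto [0, l]
   with small fibres and w x = 0.  Reading f through such maps models it by two
   maps a, a' of [0, l] fixing 0.  Models of two homeomorphisms f and g can
   therefore be glued at 0, and approximate homogeneity applied to the glued
   model yields one homeomorphism that is conjugate to approximations of both f
   and g.  Running through a countable dense set of targets g, a convergent
   sequence of such homeomorphisms has a limit whose conjugates are dense. *)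
Require Import Defs.
From mathcomp Require Import all_boot all_order all_algebra.
From mathcomp Require Import all_classical all_reals topology.
From mathcomp Require Import normedtype derive lra zify.

Set Implicit Arguments.
Unset Strict Implicit.
Unset Printing Implicit Defensive.

Import Order.TTheory GRing.Theory Num.Theory.
Import numFieldNormedType.Exports.

Local Open Scope classical_set_scope.

(** * Cutting compact spaces along components *)

(** A relatively clopen part of a closed set [Z] is represented by an open [G] whose rim misses [Z].
    If [Z] is a sublevel set {u <= b}, then u > b on the rim, so functions of u truncated to agree
    beyond b can be glued along it; the lifts below are built in this way. Disjointness of
    components needs a gap between levels, so lifts are only approximate. This is why homeomorphisms
    are obtained from nested closed relations |u x - v y| <= eta that shrink to a graph. A model
    consists of two maps because f is seen through fine maps phi and phi1, with a o phi1 close to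
    phi and a' o phi1 close to phi o f: f need not induce a map of the interval, only the relation a
    s' = a' s. Any h with a o r o h close to a' o r is then close to a conjugate of f, and
    approximate homogeneity supplies such an h. *)

Definition rim (X : topologicalType) (G : set X) := closure G `\` G.

Lemma absurd_set0 (T : Type) (A : set T) (x : T) : A = set0 -> A x -> False.
Proof. by move=> ->. Qed.

Section CompactSpaces.
Variable X : topologicalType.

(** Stands in for finite subcovers: if [P K] failed, the sets [A] with [P (K \ A)] would form a
    proper filter containing [K], and a cluster point of it would contradict the local
    hypothesis. *)
Lemma compact_ind (K : set X) (P : set X -> Prop) : compact K ->
  P set0 -> (forall A B, P A -> P B -> P (A `|` B)) ->
  (forall A B, A `<=` B -> P B -> P A) ->
  (forall x, K x -> exists2 U, nbhs x U & P U) -> P K.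
Proof.
move=> cK P0 PU PS PK; apply: contrapT => nPK.
pose F := [set A : set X | P (K `\` A)].
have FF : ProperFilter F.
  split; first by rewrite /F/= setD0.
  apply: Build_Filter => /=.
  - by rewrite /F/= setDT.
  - by move=> A B; rewrite /F/= setDIr => ? ?; exact: PU.
  - by move=> A B AB; rewrite /F/=; apply: PS; exact: setDS.
have [|x [Kx cx]] := cK F FF; first by rewrite /F/= setDv.
have [U xU PU'] := PK x Kx.
have [|y [nUy Uy]] := cx (~` U) U _ xU; last by [].
by rewrite /F/=; apply: PS PU'; rewrite setDE setCK => y [].
Qed.

Lemma rimI (G H : set X) : rim (G `&` H) `<=` rim G `|` rim H.
Proof.
move=> x [cx nx]; have [cG cH] := closureI cx.
have [Gx|nG] := pselect (G x); last by left.
by right; split=> // Hx; exact: nx.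
Qed.

Lemma rimU (G H : set X) : rim (G `|` H) `<=` rim G `|` rim H.
Proof.
move=> x [cx nx]; move: cx; rewrite closureU => -[cG|cH].
  by left; split=> // ?; apply: nx; left.
by right; split=> // ?; apply: nx; right.
Qed.

Lemma open_disjoint_closure (U V : set X) :
  open V -> U `&` V = set0 -> closure U `&` V = set0.
Proof.
move=> oV UV; apply/seteqP; split=> // x [cx Vx].
by have [y] := cx V (open_nbhs_nbhs (conj oV Vx)); rewrite UV.
Qed.

Hypothesis cX : compact [set: X].
Hypothesis hX : hausdorff_space X.

Lemma closed_compact_sub (A : set X) : closed A -> compact A.
Proof. by move=> cA; apply: subclosed_compact cX _. Qed.

Lemma closed_separation (R : realType) (A B : set X) :
  closed A -> closed B -> A `&` B = set0 ->
  exists U V, [/\ open U, open V, A `<=` U, B `<=` V & U `&` V = set0].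
Proof.
by move=> cA cB AB; exact: (@normal_openP R X).1 (compact_normal hX cX) _ _ cA cB AB.
Qed.

(* Components are quasi-components; a relatively clopen subset of [Z] is
   represented by an open set whose rim misses [Z]. *)
Lemma cut_wire (R : realType) (Z O : set X) (x : X) :
  closed Z -> Z x -> open O -> connected_component Z x `<=` O ->
  exists G, [/\ open G, connected_component Z x `<=` G, G `<=` O &
                rim G `&` Z = set0].
Proof.
move=> cZ Zx oO CO.
pose good := [set G : set X | [/\ open G, G x & rim G `&` Z = set0]].
(* The quasi-component of [x] in [Z]. *)
pose Q := \bigcap_(G in good) (G `&` Z).
have goodZ G : good G -> closure G `&` Z `<=` G.
  move=> [_ _ r0] y [cy Zy]; apply: contrapT => nGy.
  by have : (rim G `&` Z) y by []; rewrite r0.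
have goodT : good setT.
  by split=> //; [exact: openT|apply/seteqP; split=> // y [[_ /(_ I)]]].
have goodI G H : good G -> good H -> good (G `&` H).
  move=> [oG Gx rG] [oH Hx rH]; split => //; first exact: openI.
  apply/seteqP; split=> // y [/rimI[] ry Zy].
    by rewrite -rG.
  by rewrite -rH.
have cQ : closed Q.
  have -> : Q = \bigcap_(G in good) (closure G `&` Z).
    apply/seteqP; split=> y Qy G gG.
      by have [Gy Zy] := Qy G gG; split=> //; exact: subset_closure.
    by have [Gy Zy] := Qy G gG; split=> //; exact: goodZ.
  by apply: closed_bigI => G _; apply: closedI => //; exact: closed_closure.
have Qnbhs O' : open O' -> Q `<=` O' -> exists2 G, good G & G `&` Z `<=` O'.
  move=> oO' QO'.
  pose P := [set A : set X | exists2 G, good G & G `&` Z `&` A = set0].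
  have [||A B [G gG GA] [H gH HB]|A B AB [G gG GB]|y [Zy nO'y]|G gG GZ] :=
      @compact_ind (Z `\` O') P.
  - apply: closed_compact_sub; rewrite setDE.
    by apply: closedI => //; exact: open_closedC.
  - by exists setT => //; rewrite setI0.
  - exists (G `&` H); first exact: goodI.
    apply/seteqP; split=> // y [[[Gy Hy] Zy] [Ay|By]].
      by rewrite -GA.
    by rewrite -HB.
  - exists G => //; apply/seteqP; split=> // y [? /AB ?].
    by rewrite -GB.
  - have /existsNP[G /not_implyP[gG nGy]] : ~ Q y by move=> /QO'.
    exists (~` closure G).
      apply: open_nbhs_nbhs; split.
        exact/closed_openC/closed_closure.
      by move=> cy; apply: nGy; split=> //; exact: goodZ.
    exists G => //; apply/seteqP; split=> // z [[Gz _]]; apply.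
    exact: subset_closure.
  exists G => // y [Gy Zy]; apply: contrapT => nO'.
  by have : (G `&` Z `&` (Z `\` O')) y by []; rewrite GZ.
have Qx : Q x by move=> G [].
(* A separation of [Q] would be inherited by a good set: its intersection with a neighbourhood of
   the part containing [x] is again good and excludes the other part. *)
have Qsplit P1 P2 : closed P1 -> closed P2 -> P1 `&` P2 = set0 -> 
    Q = P1 `|` P2 -> P1 x -> P2 = set0.
  move=> c1 c2 P12 QP P1x.
  have [U1 [U2 [oU1 oU2 PU1 PU2 U12]]] := closed_separation R c1 c2 P12.
  have [||G gG GU] := Qnbhs (U1 `|` U2); first exact: openU.
    by rewrite QP => y [/PU1|/PU2]; [left|right].
  have [oG Gx rG] := gG.
  have gG1 : good (G `&` U1).
    split; [exact: openI|split=> //; exact: PU1|].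
    apply/seteqP; split=> // y [[/closureI[cGy cUy] nGU] Zy].
    have Gy : G y by exact: goodZ.
    have [U1y|U2y] := GU y (conj Gy Zy); first by case: nGU.
    by rewrite -(open_disjoint_closure oU2 U12); split.
  apply/seteqP; split=> // y P2y.
  have Qy : Q y by rewrite QP; right.
  have [[_ U1y] _] := Qy _ gG1.
  by rewrite -U12; split=> //; exact: PU2.
have conQ : connected Q.
  move=> B [b Bb] [C oC BC] [D cD BD].
  have cB : closed B by rewrite BD; exact: closedI.
  have cQB : closed (Q `\` B).
    have -> : Q `\` B = Q `&` ~` C.
      rewrite BC; apply/seteqP; split=> y [Qy nB]; split=> //.
        by move=> Cy; exact: nB.
      by move=> [].
    by apply: closedI => //; exact: open_closedC.
  have BQ : B `<=` Q by rewrite BC => y [].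
  have QB : Q = B `|` (Q `\` B) by rewrite setDUK.
  have [Bx|nBx] := pselect (B x).
    have := Qsplit _ _ cB cQB _ QB Bx; rewrite setDIK => /(_ erefl) QB0.
    by rewrite QB QB0 setU0.
  have := Qsplit _ _ cQB cB _ _ (conj Qx nBx).
  rewrite setIC setDIK setUC => /(_ erefl QB) B0.
  by rewrite B0 in Bb.
have QC : Q `<=` connected_component Z x.
  by apply: connected_component_max => // y /(_ _ goodT)[].
have CG G : good G -> connected_component Z x `<=` G.
  move=> gG; have [oG Gx rG] := gG.
  have CxZ := @connected_component_sub X Z x.
  have := @component_connected X Z x (connected_component Z x `&` G).
  move=> <-; first by move=> y [].
  - by exists x; split=> //; exact: connected_component_refl.
  - by exists G.
  - exists (closure G); first exact: closed_closure.
    apply/seteqP; split=> y [Cy Gy]; split=> //; first exact: subset_closure.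
    by apply: goodZ => //; split=> //; exact: CxZ.
have [G gG GZ] := Qnbhs O oO (subset_trans QC CO).
have [oG Gx rG] := gG.
(* [G] lies in [O] only within [Z]; intersecting with [O] creates no rim inside [Z]. *)
exists (G `&` O); split=> //.
- exact: openI.
- by move=> y Cy; split; [exact: CG|exact: CO].
- apply/seteqP; split=> // y [[/closureI[cGy cOy] nGO] Zy].
  have Gy : G y by exact: goodZ.
  by case: nGO; split=> //; exact: GZ.
Qed.

End CompactSpaces.

Local Open Scope ring_scope.

(** * Real functions on hereditarily indecomposable spaces *)

Ltac minmax := repeat match goal with
  | |- context [Num.min ?a ?b] => case: (leP a b) => ?
  | |- context [Num.max ?a ?b] => case: (leP a b) => ? end.

Section RealFunctions.
Variables (R : realType) (X : topologicalType).
Implicit Types (u v : X -> R) (a b : R).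

Lemma continuous_add u v : continuous u -> continuous v ->
  continuous (fun x => u x + v x).
Proof. by move=> cu cv x; apply: cvgD; [exact: cu|exact: cv]. Qed.

Lemma continuous_opp u : continuous u -> continuous (fun x => - u x).
Proof. by move=> cu x; apply: cvgN; exact: cu. Qed.

Lemma continuous_sub u v : continuous u -> continuous v ->
  continuous (fun x => u x - v x).
Proof. by move=> cu cv; exact: continuous_add (continuous_opp cv). Qed.

Lemma continuous_scale u a : continuous u -> continuous (fun x => a * u x).
Proof. by move=> cu x; apply: cvgM; [exact: cvg_cst|exact: cu]. Qed.

Lemma continuous_const a : continuous (fun _ : X => a).
Proof. by move=> x; exact: cvg_cst. Qed.

Lemma continuous_minr u v : continuous u -> continuous v ->
  continuous (fun x => Num.min (u x) (v x)).
Proof. by move=> cu cv x; apply: continuous_min; [exact: cu|exact: cv]. Qed.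

Lemma continuous_maxr u v : continuous u -> continuous v ->
  continuous (fun x => Num.max (u x) (v x)).
Proof. by move=> cu cv x; apply: continuous_max; [exact: cu|exact: cv]. Qed.

Lemma closed_sublevel u b : continuous u -> closed [set x | u x <= b].
Proof.
by move=> cu; apply: (@preimage_closed _ _ u [set y | y <= b]) => // ? _; exact: cu.
Qed.

Lemma closed_superlevel u b : continuous u -> closed [set x | b <= u x].
Proof.
by move=> cu; apply: (@preimage_closed _ _ u [set y | b <= y]) => // ? _; exact: cu.
Qed.

Lemma open_sublevel u b : continuous u -> open [set x | u x < b].
Proof.
move=> cu; apply: (@open_comp _ _ u [set y | y < b]); last exact: open_lt.
by move=> ? _; exact: cu.
Qed.

Lemma open_superlevel u b : continuous u -> open [set x | b < u x].
Proof.
move=> cu; apply: (@open_comp _ _ u [set y | b < y]); last exact: open_gt.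
by move=> ? _; exact: cu.
Qed.

(** On a connected space, for continuous [u]: the image of [u] is the interval from [a] to [b]. *)
Definition spans u a b :=
  [/\ forall x, a <= u x <= b, exists x, u x = a & exists x, u x = b].

Lemma spans_le u a b : spans u a b -> a <= b.
Proof. by case=> uab [x <-] _; have := uab x; lra. Qed.

Lemma spans_opp u a b c : spans u a b -> spans (fun x => c - u x) (c - b) (c - a).
Proof.
case=> uab [x ux] [y uy]; split.
- by move=> z; have := uab z; lra.
- by exists y; rewrite uy.
- by exists x; rewrite ux.
Qed.

(** Repairs the range of a lift that misses its interval slightly. The error of the affine
    correction at a point is a convex combination of the errors at the two ends. *)
Lemma spans_rescale u a b p q e : continuous u -> spans u a b -> a < b ->
  p <= q -> `|a - p| <= e -> `|b - q| <= e ->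
  exists v, [/\ continuous v, spans v p q & forall x, `|v x - u x| <= e].
Proof.
move=> cu [uab [x0 ux0] [x1 ux1]] ab pq ap bq.
have ba0 : b - a != 0 by lra.
exists (fun x => p + (q - p) / (b - a) * (u x - a)); split.
- apply: continuous_add; first exact: continuous_const.
  by apply: continuous_scale; apply: continuous_sub => //; exact: continuous_const.
- split.
  + move=> x; have /andP[ua ub] := uab x.
    have h0 : 0 <= (q - p) / (b - a) by apply: divr_ge0; lra.
    have h1 : 0 <= (q - p) / (b - a) * (u x - a) by apply: mulr_ge0; lra.
    have h2 : (q - p) / (b - a) * (u x - a) <= q - p.
      rewrite mulrAC -mulrA ler_piMr; first by lra.
        by lra.
      by rewrite ler_pdivrMr; lra.
    lra.
  + by exists x0; rewrite ux0 subrr mulr0 addr0.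
  + by exists x1; rewrite ux1 divfK //; lra.
- move=> x; have /andP[ua ub] := uab x.
  set l := (u x - a) / (b - a).
  have l0 : 0 <= l by apply: divr_ge0; lra.
  have l1 : l <= 1 by rewrite /l ler_pdivrMr; lra.
  have uE : u x = a + l * (b - a) by rewrite /l divfK //; lra.
  have -> : p + (q - p) / (b - a) * (u x - a) - u x =
      (1 - l) * (p - a) + l * (q - b).
    by rewrite mulrAC -mulrA -/l; rewrite [in LHS]uE; lra.
  clearbody l.
  rewrite (le_trans (ler_normD _ _)) // !normrM (ger0_norm l0).
  have -> : `|1 - l| = 1 - l by apply: ger0_norm; lra.
  rewrite distrC in ap; rewrite distrC in bq.
  have : (1 - l) * `|p - a| <= (1 - l) * e by apply: ler_wpM2l => //; lra.
  have : l * `|q - b| <= l * e by apply: ler_wpM2l => //; lra.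
  lra.
Qed.

Lemma connected_ivt u x y c : connected [set: X] -> continuous u ->
  u x <= c <= u y -> exists z, u z = c.
Proof.
move=> conX cu /andP[xc cy].
have : is_interval (range u).
  apply/connected_intervalP; apply: connected_continuous_connected => //.
  exact: continuous_subspaceT.
have rx w : range u (u w) by exists w.
move=> ivl; have [|z _ zc] := ivl (u x) (u y) (rx x) (rx y) c; first lra.
by exists z.
Qed.

Lemma glue_continuous (Y : topologicalType) (G : set X) (f g : X -> Y) :
  open G -> continuous f -> continuous g -> (forall x, rim G x -> f x = g x) ->
  continuous (fun x => if x \in G then f x else g x).
Proof.
move=> oG cf cg fg x V /= hV.
suff: nbhs x ((fun y => if y \in G then f y else g y) @^-1` V) by [].
move: hV; case: ifPn => [|].
  rewrite inE => Gx fV; have nG : nbhs x G by exact: open_nbhs_nbhs.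
  have {}fV : nbhs x (f @^-1` V) by exact: cf.
  by apply: (filterS2 _ _ nG fV) => y Gy; rewrite /= => Vy; rewrite mem_set.
rewrite notin_setE => nGx gV.
have {}gV' : nbhs x (g @^-1` V) by exact: cg.
have [cGx|ncGx] := pselect (closure G x).
  have fV : nbhs x (f @^-1` V) by apply: cf; rewrite fg.
  by apply: (filterS2 _ _ fV gV') => y; rewrite /= => fy gy; case: ifP.
have nG : nbhs x (~` closure G).
  by apply: open_nbhs_nbhs; split => //; exact/closed_openC/closed_closure.
apply: (filterS2 _ _ nG gV') => y ny; rewrite /= => gy.
by case: ifPn => //; rewrite inE => /subset_closure.
Qed.

End RealFunctions.

Arguments closed_sublevel {R X u} b.
Arguments closed_superlevel {R X u} b.
Arguments open_sublevel {R X u} b.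
Arguments open_superlevel {R X u} b.

(** * Nested subcontinua and simultaneous cuts *)

Section HereditarilyIndecomposable.
Variables (R : realType) (X : topologicalType).
Hypothesis cX : compact [set: X].
Hypothesis hX : hausdorff_space X.
Hypothesis iX : hereditarily_indecomposable X.

Lemma subcontinua_nested (A B : set X) : subcontinuum A -> subcontinuum B ->
  A `&` B !=set0 -> A `<=` B \/ B `<=` A.
Proof.
move=> [conA cA] [conB cB] AB.
have [AsB|nAB] := pselect (A `<=` B); first by left.
have [BsA|nBA] := pselect (B `<=` A); first by right.
exfalso; apply: (iX (Y := A `|` B)).
  by split; [exact: connectedU|exact: compactU].
exists A, B; split=> //; split; [exact: subsetUl| |exact: subsetUr|].
- by move=> s; apply: nBA => x Bx; apply: s; right.
- by move=> s; apply: nAB => x Ax; apply: s; left.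
Qed.

Lemma component_subcontinuum (Z : set X) (x : X) : closed Z ->
  subcontinuum (connected_component Z x).
Proof.
move=> cZ; split; first exact: component_connected.
by apply: closed_compact_sub => //; exact: component_closed.
Qed.

Lemma components_nested (Z Z' : set X) (p q z : X) : closed Z -> closed Z' ->
  connected_component Z p z -> connected_component Z' q z ->
  connected_component Z p `<=` connected_component Z' q \/
  connected_component Z' q `<=` connected_component Z p.
Proof.
move=> cZ cZ' pz qz; apply: subcontinua_nested; last by exists z.
- exact: component_subcontinuum.
- exact: component_subcontinuum.
Qed.

(** [cut_wire] gives such a pair for single points [p], [q]. Pairs combine by intersection on one
    side and union on the other, so compactness of [B] treats all [q] for a fixed [p], and then
    compactness of [A] treats all [p]. *)
Lemma rim_separation (Z Z' A B : set X) :
  closed Z -> closed Z' -> closed A -> closed B -> A `<=` Z -> B `<=` Z' ->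
  (forall p q, A p -> B q ->
    connected_component Z p `&` connected_component Z' q = set0) ->
  exists G G', [/\ [/\ open G, A `<=` G & rim G `&` Z = set0],
    [/\ open G', B `<=` G' & rim G' `&` Z' = set0] & G `&` G' = set0].
Proof.
move=> cZ cZ' cA cB AZ BZ' dis.
pose good := fun G G' : set X => [/\ open G, rim G `&` Z = set0,
  open G', rim G' `&` Z' = set0 & G `&` G' = set0].
have good0 : good setT set0.
  split; [exact: openT| |exact: open0| |by rewrite setI0].
    by apply/seteqP; split=> // y [[_ /(_ I)]].
  by apply/seteqP; split=> // y [[+ _] _]; rewrite closure0.
have good0' : good set0 setT.
  split; [exact: open0| |exact: openT| |by rewrite set0I].
    by apply/seteqP; split=> // y [[+ _] _]; rewrite closure0.
  by apply/seteqP; split=> // y [[_ /(_ I)]].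
have rim0U G H W : rim G `&` W = set0 -> rim H `&` W = set0 ->
    rim (G `|` H) `&` W = set0.
  move=> rG rH; apply/seteqP; split=> // y [/rimU[] r Wy].
    by rewrite -rG.
  by rewrite -rH.
have rim0I G H W : rim G `&` W = set0 -> rim H `&` W = set0 ->
    rim (G `&` H) `&` W = set0.
  move=> rG rH; apply/seteqP; split=> // y [/rimI[] r Wy].
    by rewrite -rG.
  by rewrite -rH.
have goodUI G G' H H' : good G G' -> good H H' -> good (G `|` H) (G' `&` H').
  move=> [oG rG oG' rG' GG'] [oH rH oH' rH' HH']; split.
  - exact: openU.
  - exact: rim0U.
  - exact: openI.
  - exact: rim0I.
  - apply/seteqP; split=> // y [[Gy|Hy] [G'y H'y]].
      by rewrite -GG'.
    by rewrite -HH'.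
have goodIU G G' H H' : good G G' -> good H H' -> good (G `&` H) (G' `|` H').
  move=> [oG rG oG' rG' GG'] [oH rH oH' rH' HH']; split.
  - exact: openI.
  - exact: rim0I.
  - exact: openU.
  - exact: rim0U.
  - apply/seteqP; split=> // y [[Gy Hy] [G'y|H'y]].
      by rewrite -GG'.
    by rewrite -HH'.
have point p : A p -> exists G G', [/\ good G G', G p & B `<=` G'].
  move=> Ap.
  pose P := [set S : set X | exists G G', [/\ good G G', G p & S `<=` G']].
  have [|S T [G [G' [gG Gp SG]]] [H [H' [gH Hp TH]]]|
      S T ST [G [G' [gG Gp TG]]]|q Bq|G [G' [gG Gp BG]]] :=
      @compact_ind X B P (closed_compact_sub cX cB).
  - by exists setT, set0; split.
  - exists (G `&` H), (G' `|` H'); split=> //; first exact: goodIU.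
    exact: setUSS.
  - by exists G, G'; split=> //; exact: subset_trans TG.
  - have cZp := component_closed (x := p) cZ.
    have cZq := component_closed (x := q) cZ'.
    have [U [V [oU oV pU qV UV]]] :=
      closed_separation cX hX R cZp cZq (dis p q Ap Bq).
    have [G [oG CG GU rG]] := cut_wire cX hX R cZ (AZ p Ap) oU pU.
    have [G' [oG' CG' GV rG']] := cut_wire cX hX R cZ' (BZ' q Bq) oV qV.
    exists G'.
      apply: open_nbhs_nbhs; split=> //.
      by apply: CG'; apply: connected_component_refl; exact: BZ'.
    exists G, G'; split=> //.
      split=> //; apply/seteqP; split=> // y [/GU ? /GV ?].
      by rewrite -UV.
    by apply: CG; apply: connected_component_refl; exact: AZ.
  - by exists G, G'.
pose P := [set S : set X | exists G G', [/\ good G G', S `&` A `<=` G & B `<=` G']].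
have [|S T [G [G' [gG SG BG]]] [H [H' [gH TH BH]]]|
    S T ST [G [G' [gG TG BG]]]|p Ap|G [G' [[? ? ? ? ?]]]] :=
    @compact_ind X A P (closed_compact_sub cX cA).
- by exists set0, setT; split=> //; rewrite set0I.
- exists (G `|` H), (G' `&` H'); split=> //; first exact: goodUI.
    by rewrite setIUl; exact: setUSS.
  by move=> y By; split; [exact: BG|exact: BH].
- by exists G, G'; split=> //; apply: subset_trans TG; exact: setSI.
- have [G [G' [gG Gp BG]]] := point p Ap; have [oG _ _ _ _] := gG.
  exists G; first exact: open_nbhs_nbhs.
  by exists G, G'; split=> // y [].
- by rewrite setIid => ? ?; exists G, G'.
Qed.

End HereditarilyIndecomposable.

(** * Lifting over a single fold *)

Section Folds.
Variable R : realType.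
Implicit Types (a b c l s : R).

(** An N-shaped graph: up to the value [b], down to [a], reached at 2b - a, and up again. *)
Definition nfold a b s := if s <= b then s
  else if s <= 2 * b - a then 2 * b - s else s - 2 * (b - a).

(** A single turn at [l]; in the coordinate measured from the turning point it is the absolute
    value, see [vfold_reflect]. *)
Definition vfold l s := Num.min s (2 * l - s).

Definition clip a b s := Num.max a (Num.min b s).

Lemma nfold_low a b s : s <= b -> nfold a b s = s.
Proof. by rewrite /nfold => ->. Qed.

Lemma nfold_mid a b s : a <= s <= b -> nfold a b (2 * b - s) = s.
Proof. by rewrite /nfold => sab; do ?case: ifPn => ?; lra. Qed.

Lemma nfold_high a b s : a <= b -> a <= s -> nfold a b (s + 2 * (b - a)) = s.
Proof. by rewrite /nfold => ab sa; do ?case: ifPn => ?; lra. Qed.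

Lemma nfold_lipschitz a b s s' : a <= b ->
  `|nfold a b s - nfold a b s'| <= `|s - s'|.
Proof.
move=> ab; wlog ss' : s s' / s <= s' => [H|].
  have [|/ltW] := leP s s'; first exact: H.
  by move=> /H; rewrite distrC (distrC s').
rewrite (distrC s) (ger0_norm (_ : 0 <= s' - s)); last by lra.
rewrite ler_norml /nfold; case: (leP s b) => ?; case: (leP s' b) => ?;
  do ?case: ifPn => ?; lra.
Qed.

(** Prefixing a straight piece of length [p] to a fold gives a fold; this transports folds from the
    tail of a zigzag to the zigzag. *)
Lemma nfold_shift a b p s : 0 <= a -> a < b -> 0 < p ->
  (s <= p -> nfold (a + p) (b + p) s = s) /\
  (p <= s -> nfold (a + p) (b + p) s = p + nfold a b (s - p)).
Proof.
rewrite /nfold => a0 ab p0; split=> sp; first by rewrite ifT //; lra.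
by do ?case: ifPn => ?; lra.
Qed.

Lemma vfold_reflect l s : vfold l (l - s) = l - `|s|.
Proof.
by rewrite /vfold; case: (leP 0 s) => h;
  [rewrite ger0_norm|rewrite ltr0_norm] => //; minmax; lra.
Qed.

Lemma vfold_shift l p s : 0 <= l -> 0 < p ->
  (s <= p -> vfold (p + l) s = s) /\
  (p <= s -> vfold (p + l) s = p + vfold l (s - p)).
Proof. by rewrite /vfold => l0 p0; split=> sp; minmax; lra. Qed.

Lemma clip_bounds a b s : a <= b -> a <= clip a b s <= b.
Proof. by rewrite /clip; minmax; lra. Qed.

Lemma clip_above a b s : a <= b -> b <= s -> clip a b s = b.
Proof. by rewrite /clip => ab; minmax; lra. Qed.

Lemma clip_below a b s : a <= b -> s <= a -> clip a b s = a.
Proof. by rewrite /clip => ab; minmax; lra. Qed.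

Lemma clip_near a b s e : a <= b -> 0 <= e -> a - e <= s <= b + e ->
  `|clip a b s - s| <= e.
Proof. by rewrite /clip => ab e0; rewrite ler_norml; minmax; lra. Qed.

Variable X : topologicalType.
Hypothesis cX : compact [set: X].
Hypothesis hX : hausdorff_space X.
Hypothesis conX : connected [set: X].
Hypothesis iX : hereditarily_indecomposable X.

Implicit Types u v : X -> R.

Lemma continuous_clip u a b : continuous u -> continuous (fun x => clip a b (u x)).
Proof.
move=> cu; apply: continuous_maxr; first exact: continuous_const.
by apply: continuous_minr => //; exact: continuous_const.
Qed.

(** Boundary bumping: a component missing the level [c] could be cut off by an open [G] within {u <
    c} whose rim misses {u <= c}; such a [G] is clopen, against connectedness. *)
Lemma component_reaches u z c : continuous u -> u z <= c ->
  (exists x, c < u x) -> 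
  exists2 w, connected_component [set x | u x <= c] z w & u w = c.
Proof.
move=> cu zc [x1 x1c]; apply: contrapT => nw.
have cZ := closed_sublevel (c) cu.
have oO := open_sublevel (c) cu.
have CO : connected_component [set x | u x <= c] z `<=` [set x | u x < c].
  move=> w Cw /=; rewrite lt_neqAle (connected_component_sub Cw) andbT.
  by apply/eqP => uw; apply: nw; exists w.
have [G [oG CG GO rG]] := cut_wire cX hX R cZ zc oO CO.
have cGZ : closure G `<=` [set x | u x <= c].
  rewrite [X in _ `<=` X](closure_id _).1 //; apply: closureS.
  by move=> y /GO /ltW.
have cG : closed G.
  move=> y cGy; apply: contrapT => nGy.
  by apply: (absurd_set0 rG (x := y)); split=> //; exact: cGZ.
have Gz : G z by apply: CG; exact: connected_component_refl.
have GT : G = setT.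
  apply: conX; [by exists z|by exists G; rewrite ?setTI|by exists G; rewrite ?setTI].
have : G x1 by rewrite GT.
by move=> /GO /=; lra.
Qed.

(** The lift uses the first branch of the fold on [G], which contains {u <= a}, the third on [G'],
    which contains {b <= u}, and the descending one elsewhere, where [u] lies between [a] and
    [b]. *)
Lemma nfold_lift u l a b e : continuous u -> spans u 0 l ->
  0 <= a -> a < b -> b <= l -> 0 < e ->
  exists v, [/\ continuous v, spans v 0 (l + 2 * (b - a)) &
                forall x, `|nfold a b (v x) - u x| <= e].
Proof.
move=> cu su a0 ab bl e0; have [ul [x0 ux0] [x1 ux1]] := su.
(* The margin [d] at both levels costs an error of 5d, and the final rescaling another 4d. *)
pose d := Num.min (e / 9) ((b - a) / 5).
have d0 : 0 < d by rewrite /d; minmax; lra.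
have de : d <= e / 9 by rewrite /d; minmax; lra.
have dab : d <= (b - a) / 5 by rewrite /d; minmax; lra.
clearbody d; pose a' := a + d; pose b' := b - d.
(* A component of [u <= b'] meeting [u <= a] and a component of [a' <= u] meeting
   [b <= u] cannot be nested, hence they are disjoint. *)
have AZ : [set x | u x <= a] `<=` [set x | u x <= b'].
  by move=> x /=; rewrite /b'; lra.
have BZ : [set x | b <= u x] `<=` [set x | a' <= u x].
  by move=> x /=; rewrite /a'; lra.
have [|G [G' [[oG AG rG] [oG' BG' rG'] GG']]] := rim_separation R cX hX
  (closed_sublevel b' cu) (closed_superlevel a' cu)
  (closed_sublevel a cu) (closed_superlevel b cu) AZ BZ.
  move=> p q /= up uq; apply/seteqP; split=> // z [pz qz].
  have Cp : connected_component [set x | u x <= b'] p p.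
    by apply: connected_component_refl; rewrite /= /b'; lra.
  have Cq : connected_component [set x | a' <= u x] q q.
    by apply: connected_component_refl; rewrite /= /a'; lra.
  have [pq|qp] := components_nested cX iX
    (closed_sublevel (b') cu) (closed_superlevel (a') cu) pz qz.
    by have := connected_component_sub (pq _ Cp); rewrite /= /a'; lra.
  by have := connected_component_sub (qp _ Cq); rewrite /= /b'; lra.
have ab' : a' < b' by rewrite /a' /b'; lra.
pose mid x := 2 * b' - clip a' b' (u x).
pose v1 x := if x \in G' then Num.max a' (u x) + 2 * (b' - a') else mid x.
pose v x := if x \in G then Num.min b' (u x) else v1 x.
(* On the rims [u] has left the interval from [a'] to [b'], so the truncated branches agree: both
   are [b'] on the rim of [G], and 2b' - a' on the rim of [G']. *)
have rimG x : rim G x -> b' < u x.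
  move=> rx; rewrite ltNge; apply/negP => ux.
  by apply: (absurd_set0 rG (x := x)).
have rimG' x : rim G' x -> u x < a'.
  move=> rx; rewrite ltNge; apply/negP => ux.
  by apply: (absurd_set0 rG' (x := x)).
have cmid : continuous mid.
  apply: continuous_sub; first exact: continuous_const.
  exact: continuous_clip.
have cv1 : continuous v1.
  apply: glue_continuous => //.
    apply: continuous_add; last exact: continuous_const.
    by apply: continuous_maxr => //; exact: continuous_const.
  move=> x /rimG' ux; rewrite /mid clip_below ?ltW // (elimT max_idPl) ?ltW //.
  by rewrite /a' /b'; lra.
have cv : continuous v.
  apply: glue_continuous => //.
    by apply: continuous_minr => //; exact: continuous_const.
  move=> x rx; have [cGx _] := rx; have ux := rimG _ rx.
  rewrite /v1 ifF.
    by rewrite /mid clip_above ?ltW // (elimT min_idPl) ?ltW //; lra.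
  apply/negbTE; rewrite notin_setE => G'x.
  by apply: (absurd_set0 (open_disjoint_closure oG' GG') (x := x)).
have Gu x : x \in G -> u x < b.
  rewrite inE => Gx; rewrite ltNge; apply/negP => /BG' G'x.
  by apply: (absurd_set0 GG' (x := x)).
have nGu x : x \notin G -> a < u x.
  by rewrite notin_setE => nGx; rewrite ltNge; apply/negP => /AG.
have G'u x : x \in G' -> a < u x.
  rewrite inE => G'x; rewrite ltNge; apply/negP => /AG Gx.
  by apply: (absurd_set0 GG' (x := x)).
have nG'u x : x \notin G' -> u x < b.
  by rewrite notin_setE => nGx; rewrite ltNge; apply/negP => /BG'.
have sv : spans v 0 (l + 2 * (b' - a')).
  split.
  - move=> x; have := ul x; rewrite /v /v1 /mid; case: ifPn => [/Gu|/nGu].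
      by rewrite /a' /b'; clear - d0 dab a0 ab bl; minmax; lra.
    move=> ?; case: ifPn => [/G'u|/nG'u]; rewrite /clip /a' /b';
      clear - d0 dab a0 ab bl; minmax; lra.
  - exists x0; rewrite /v ifT; last by rewrite inE; apply: AG; rewrite /= ux0.
    by rewrite ux0 /b'; minmax; lra.
  - exists x1; have G'x1 : x1 \in G' by rewrite inE; apply: BG'; rewrite /= ux1.
    rewrite /v /v1 G'x1 ifF; first by rewrite ux1 /a' /b'; minmax; lra.
    apply/negbTE; rewrite notin_setE => Gx1; move: G'x1; rewrite inE => G'x1.
    by apply: (absurd_set0 GG' (x := x1)).
have vu x : `|nfold a b (v x) - u x| <= 5 * d.
  rewrite /v /v1 /mid; case: ifPn => [/Gu|/nGu] ux.
    rewrite nfold_low; last by rewrite /b'; minmax; lra.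
    by rewrite ler_norml /b'; minmax; lra.
  case: ifPn => [_|/nG'u ux'].
    set y := Num.max a' (u x).
    have ya : a <= y by rewrite /y le_max; apply/orP; right; lra.
    have yu : `|y - u x| <= d by rewrite ler_norml /y /a'; minmax; lra.
    have := nfold_lipschitz (y + 2 * (b' - a')) (y + 2 * (b - a)) (ltW ab).
    have -> : y + 2 * (b' - a') - (y + 2 * (b - a)) = - (4 * d).
      by rewrite /a' /b'; lra.
    rewrite (nfold_high (ltW ab) ya) normrN (gtr0_norm (_ : 0 < 4 * d)); last by lra.
    by move: yu; rewrite !ler_norml; lra.
  set y := clip a' b' (u x).
  have yab : a <= y <= b.
    by have := clip_bounds (u x) (ltW ab'); rewrite -/y /a' /b'; lra.
  have yu : `|y - u x| <= d.
    by apply: clip_near; rewrite /a' /b'; lra.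
  have := nfold_lipschitz (2 * b' - y) (2 * b - y) (ltW ab).
  have -> : 2 * b' - y - (2 * b - y) = - (2 * d) by rewrite /b'; lra.
  rewrite nfold_mid // normrN (gtr0_norm (_ : 0 < 2 * d)); last by lra.
  by move: yu; rewrite !ler_norml; lra.
have [||||w [cw sw wv]] := spans_rescale (q := l + 2 * (b - a)) (p := 0)
  (e := 4 * d) cv sv.
- by rewrite /a' /b'; lra.
- by lra.
- by rewrite ler_norml; lra.
- by rewrite ler_norml /a' /b'; lra.
exists w; split=> // x.
have := le_trans (nfold_lipschitz _ _ (ltW ab)) (wv x).
by have := vu x; rewrite !ler_norml; lra.
Qed.

(** With u' = l - u the task is to find a signed function whose absolute value is close to [u'] and
    whose values run from [- c] to [l]: the sign of [u'] is to be flipped on a suitable open set. *)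
Lemma vfold_lift u l c e : continuous u -> spans u 0 l ->
  0 < c -> c <= l -> 0 < e ->
  exists v, [/\ continuous v, spans v 0 (l + c) &
                forall x, `|vfold l (v x) - u x| <= e].
Proof.
move=> cu0 su0 c0 cl e0.
pose u' x := l - u x.
have cu : continuous u' by apply: continuous_sub => //; exact: continuous_const.
have su : spans u' 0 l by have := spans_opp l su0; rewrite subrr subr0.
have [ul [z uz] [x1 ux1]] := su.
pose d := Num.min (e / 9) (c / 9).
have d0 : 0 < d by rewrite /d; minmax; lra.
have de : d <= e / 9 by rewrite /d; minmax; lra.
have dc : d <= c / 9 by rewrite /d; minmax; lra.
clearbody d; pose c1 := c - 2 * d.
have dc1 : d < c1 by rewrite /c1; lra.
(* The component of [w] in [d <= u'] lies below [c1], because the component of [w]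
   in [u' <= c1] contains the point [z], where [u'] vanishes: it can be flipped. *)
have [|| w Cw uw] := @component_reaches u' z c1 cu; first by rewrite uz /c1; lra.
  by exists x1; rewrite ux1 /c1; lra.
have cD := closed_superlevel (d) cu.
have cC := closed_sublevel (c1) cu.
have Dw : connected_component [set x | d <= u' x] w w.
  by apply: connected_component_refl; rewrite /= uw /c1; lra.
have Cz : connected_component [set x | u' x <= c1] z z.
  by apply: connected_component_refl; rewrite /= uz /c1; lra.
have DC : connected_component [set x | d <= u' x] w `<=` [set x | u' x < c - d].
  have [CD|DC] := components_nested cX iX cC cD Cw Dw.
    by have := connected_component_sub (CD _ Cz); rewrite /= uz; lra.
  by move=> y /DC /connected_component_sub /=; rewrite /c1; lra.
have [G [oG DG GO rG]] := cut_wire cX hX R cD (connected_component_sub Dw)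
  (open_sublevel (c - d) cu) DC.
have rimG x : rim G x -> u' x < d.
  move=> rx; rewrite ltNge; apply/negP => ux.
  by apply: (absurd_set0 rG (x := x)).
(* On the rim of [G] one has u' < d, so both branches vanish. The minimum is taken at [w], where u'
   = c1. *)
pose v x := if x \in G then d - clip d c1 (u' x) else Num.max d (u' x) - d.
have cv : continuous v.
  apply: glue_continuous => //.
  - by apply: continuous_sub; [exact: continuous_const|exact: continuous_clip].
  - apply: continuous_sub; last exact: continuous_const.
    by apply: continuous_maxr => //; exact: continuous_const.
  - move=> x /rimG ux.
    by rewrite clip_below ?ltW // (elimT max_idPl) ?ltW // !subrr.
have sv : spans v (d - c1) (l - d).
  split.
  - move=> x; rewrite /v; case: ifPn => _.
      by have := clip_bounds (u' x) (ltW dc1); rewrite /c1; lra.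
    by have := ul x; rewrite /c1; minmax; lra.
  - exists w; rewrite /v ifT.
      by rewrite clip_above ?uw // ltW.
    by rewrite inE; exact: DG.
  - exists x1; rewrite /v ifF; first by rewrite ux1; minmax; lra.
    by apply/negbTE; rewrite notin_setE => /GO /=; rewrite ux1; lra.
have [||||v' [cv' sv' v'v]] := spans_rescale (p := - c) (q := l)
  (e := 3 * d) cv sv.
- by rewrite /c1; lra.
- by lra.
- by rewrite ler_norml /c1; lra.
- by rewrite ler_norml; lra.
exists (fun x => l - v' x); split.
- by apply: continuous_sub => //; exact: continuous_const.
- by have := spans_opp l sv'; rewrite opprK subrr.
- move=> x; rewrite vfold_reflect.
  have -> : u x = l - u' x by rewrite /u'; lra.
  have vu : `| `|v x| - u' x| <= 2 * d.
    have /andP[u'0 _] := ul x; rewrite /v; case: ifPn => [|_].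
      rewrite inE => /GO /= ux; have := clip_bounds (u' x) (ltW dc1) => cb.
      have : `|clip d c1 (u' x) - u' x| <= d.
        by apply: clip_near; [exact: ltW|exact: ltW|rewrite /c1; lra].
      have -> : `|d - clip d c1 (u' x)| = clip d c1 (u' x) - d.
        by rewrite distrC ger0_norm //; lra.
      by rewrite !ler_norml; lra.
    rewrite ger0_norm; last by rewrite subr_ge0 le_max lexx.
    by rewrite ler_norml; minmax; lra.
  have := le_trans (ler_dist_dist (v' x) (v x)) (v'v x).
  by move: vu; move: `|v x| `|v' x| => p q; rewrite !ler_norml; lra.
Qed.

End Folds.

(** * Lifting over zigzags *)

Section Zigzags.
Variable R : realType.
Implicit Types (a b c p q r s lo hi e : R) (l : seq R).

(* Slopes +1 and -1 alternately, with linear pieces of lengths [l]; constant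
   after the last piece. *)
Fixpoint zigzag l s := if l is p :: l' then
  if s <= p then s else p - zigzag l' (s - p) else 0.

Definition zlength l : R := foldr +%R 0 l.

Lemma zlength_cons p l : zlength (p :: l) = p + zlength l. Proof. by []. Qed.

Definition positive l := all (fun p : R => 0 < p) l.

Lemma zlength_ge0 l : positive l -> 0 <= zlength l.
Proof.
by elim: l => //= p l IHl /andP[p0 /IHl]; rewrite /zlength /= -/(zlength l); lra.
Qed.

Lemma zigzag0 l : positive l -> zigzag l 0 = 0.
Proof. by case: l => //= p l /andP[p0 _]; rewrite ifT //; lra. Qed.

Lemma zigzag_shift p l s : positive l -> 0 <= s -> zigzag (p :: l) (p + s) = p - zigzag l s.
Proof.
move=> l0 s0 /=; case: ifPn => [ps|_]; last by rewrite addrAC subrr add0r.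
have -> : s = 0 by lra.
by rewrite zigzag0 // addr0 subr0.
Qed.

Lemma zigzag_lipschitz l s s' : positive l ->
  `|zigzag l s - zigzag l s'| <= `|s - s'|.
Proof.
wlog ss' : s s' / s <= s' => [H l0|].
  have [|/ltW] := leP s s'; first by move=> /H; exact.
  by move=> /H /(_ l0); rewrite distrC (distrC s').
rewrite (distrC s) (ger0_norm (_ : 0 <= s' - s)); last by lra.
elim: l s s' ss' => [|p l IHl] s s' ss' /=; first by move=> _; rewrite subrr normr0; lra.
move=> /andP[p0 l0]; case: ifPn => sp; case: ifPn => s'p.
- by rewrite ler_norml; lra.
- have h : 0 <= s' - p by lra.
  by have := IHl _ _ h l0; rewrite zigzag0 // !ler_norml; lra.
- by lra.
- have h : s - p <= s' - p by lra.
  by have := IHl _ _ h l0; rewrite !ler_norml; lra.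
Qed.

Definition zigzag_range l lo hi :=
  [/\ forall s, 0 <= s <= zlength l -> lo <= zigzag l s <= hi,
      exists2 s, 0 <= s <= zlength l & zigzag l s = lo &
      exists2 s, 0 <= s <= zlength l & zigzag l s = hi].

(** The side conditions are those of [nfold_lift] and [vfold_lift]. Only lengths are recorded here;
    that the zigzag factors through the fold is a separate clause of [exists_fold_reduction]. *)
Inductive fold_reduction l l' : (R -> R) -> Prop :=
| InnerFold a b of 0 <= a & a < b & b <= zlength l' &
    zlength l = zlength l' + 2 * (b - a) : fold_reduction l l' (nfold a b)
| EndFold c of 0 < c & c <= zlength l' & zlength l = zlength l' + c :
    fold_reduction l l' (vfold (zlength l')).

Lemma fold_reduction_image l l' F s : positive l' -> fold_reduction l l' F ->
  0 <= s <= zlength l -> 0 <= F s <= zlength l'.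
Proof.
move=> l'0 [a b a0 ab bl ->|c c0 cl ->] /andP[s0 sl].
  rewrite /nfold; case: ifPn => ?; [|case: ifPn => ?]; lra.
by rewrite /vfold; minmax; lra.
Qed.

Lemma fold_reduction_onto l l' F s : positive l' -> fold_reduction l l' F ->
  0 <= s <= zlength l' -> exists2 s', 0 <= s' <= zlength l & F s' = s.
Proof.
move=> l'0 [a b a0 ab bl ->|c c0 cl ->] sl.
  have [sb|bs] := leP s b.
    by exists s; [lra|rewrite /nfold sb].
  exists (s + 2 * (b - a)); first by lra.
  by rewrite /nfold; case: ifPn => ?; [lra|case: ifPn => ?; lra].
by exists s; [lra|rewrite /vfold; minmax; lra].
Qed.

Lemma zigzag_inner_fold p q r l s : 0 < q -> q <= p -> q <= r ->
  zigzag [:: p, q, r & l] s = zigzag (p - q + r :: l) (nfold (p - q) p s).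
Proof.
move=> q0 qp qr; rewrite /nfold /=.
have E : s - 2 * (p - (p - q)) - (p - q + r) = s - p - q - r by lra.
by case: (leP s p) => ? /=; [|case: (leP s (2 * p - (p - q))) => ? /=];
  do ?case: ifPn => ?; rewrite ?E; lra.
Qed.

(* The first piece that is no longer than its successor is shorter than both its
   neighbours and is removed by an inner fold; if there is none, the last piece
   is the shortest one and is removed by an end fold. *)
Lemma exists_fold_reduction p q l : positive (p :: q :: l) -> q < p ->
  exists l' F, [/\ (size l' < size (p :: q :: l))%N, l' != [::], positive l',
    fold_reduction (p :: q :: l) l' F &
    forall s, 0 <= s <= zlength (p :: q :: l) ->
      zigzag (p :: q :: l) s = zigzag l' (F s)].
Proof.
elim: l p q => [|r l IHl] p q /=.
  move=> /and3P[p0 q0 _] qp; exists [:: p], (vfold (zlength [:: p])); split=> //=.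
  - by rewrite p0.
  - by apply: (@EndFold _ _ q) => //; rewrite /zlength /=; lra.
  - rewrite /zlength /vfold /= => s ?; minmax; do ?case: ifPn => ?; lra.
move=> /and4P[p0 q0 r0 l0] qp; have lT := zlength_ge0 l0.
have [qr|rq] := leP q r.
  exists (p - q + r :: l), (nfold (p - q) p); split=> //=.
  - by rewrite l0 andbT; lra.
  - by apply: InnerFold; rewrite /zlength /= -/(zlength l); lra.
  - by move=> s _; apply: zigzag_inner_fold; lra.
have qrl : positive (q :: r :: l) by rewrite /= q0 r0.
have [l' [F [sl' l'n l'0 red zE]]] := IHl q r qrl rq.
have T' := zlength_ge0 l'0.
have zF F' : (forall s, s <= p -> F' s = s) ->
    (forall s, p <= s -> F' s = p + F (s - p)) ->
    forall s, 0 <= s <= zlength (p :: q :: r :: l) ->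
      zigzag (p :: q :: r :: l) s = zigzag (p :: l') (F' s).
  move=> F'1 F'2 s; rewrite zlength_cons => sT.
  have [sp|ps] := leP s p; first by rewrite F'1 //= sp.
  have sT' : 0 <= s - p <= zlength (q :: r :: l) by lra.
  rewrite F'2; last by lra.
  have /andP[Fs _] := fold_reduction_image l'0 red sT'.
  have h : 0 <= s - p by lra.
  rewrite (zigzag_shift p l'0 Fs) -zE // -(zigzag_shift p qrl h).
  by congr zigzag; lra.
case: red zE zF => [a b a0 ab bl Tl|c c0 cl Tl] zE zF.
  exists (p :: l'), (nfold (a + p) (b + p)); split=> //=.
  - by rewrite p0.
  - by apply: InnerFold; move: Tl; rewrite ?zlength_cons; lra.
  - by apply: zF => s; have [] := nfold_shift s a0 ab p0.
exists (p :: l'), (vfold (zlength (p :: l'))); split=> //=.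
- by rewrite p0.
- by apply: (@EndFold _ _ c) => //; move: Tl; rewrite !zlength_cons; lra.
- by apply: zF => s; have [] := vfold_shift s T' p0.
Qed.

Variable X : topologicalType.
Hypothesis cX : compact [set: X].
Hypothesis hX : hausdorff_space X.
Hypothesis conX : connected [set: X].
Hypothesis iX : hereditarily_indecomposable X.

Lemma fold_reduction_lift l l' F (u : X -> R) e : positive l' ->
  fold_reduction l l' F -> continuous u -> spans u 0 (zlength l') -> 0 < e ->
  exists v, [/\ continuous v, spans v 0 (zlength l) &
                forall x, `|F (v x) - u x| <= e].
Proof.
move=> l'0 [a b a0 ab bl ->|c c0 cl ->] cu su e0.
  exact: nfold_lift.
exact: vfold_lift.
Qed.

(** Induction on the number of pieces. If the second piece is shorter than the first, a fold
    reduction applies. If p <= q, the first piece can be folded onto the second: the zigzag at s is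
    p minus the zigzag of the tail at |s - p|, so p - u is lifted over the tail and the result over
    an end fold. *)
Lemma zigzag_lift l lo hi (u : X -> R) e : positive l -> l != [::] ->
  zigzag_range l lo hi -> continuous u -> spans u lo hi -> 0 < e ->
  exists v, [/\ continuous v, spans v 0 (zlength l) &
                forall x, `|zigzag l (v x) - u x| <= e].
Proof.
move: {2}(size l) (leqnn (size l)) => n.
elim: n l lo hi u e => [|n IHn] [|p [|q l]] // lo hi u e.
  move=> _ /= /andP[p0 _] _ [zl [s1 s1T z1] [s2 s2T z2]] cu su e0.
  have T : zlength [:: p] = p by rewrite /zlength /= addr0.
  have sE s : 0 <= s <= zlength [:: p] -> zigzag [:: p] s = s.
    by rewrite T /= => sp; rewrite ifT //; lra.
  rewrite !sE // in z1 z2.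
  have := zl 0; have := zl p; rewrite !sE T; try lra.
  move=> h1 h2; have lo0 : lo = 0 by move: h1 h2 s1T; rewrite T; lra.
  have hip : hi = p by move: h1 h2 s2T; rewrite T; lra.
  rewrite lo0 hip in su; exists u; rewrite addr0; split=> // x.
  have [ul _ _] := su; have := ul x => ?.
  by rewrite ifT ?subrr ?normr0; lra.
rewrite ltnS => sl l0 _ [zl [s1 s1T z1] [s2 s2T z2]] cu su e0.
have e20 : 0 < e / 2 by lra.
have [pq|qp] := leP p q; last first.
  have [l' [F [sl' l'n l'0 red zE]]] := exists_fold_reduction l0 qp.
  have zr' : zigzag_range l' lo hi.
    split.
    - move=> s sT; have [s' s'T <-] := fold_reduction_onto l'0 red sT.
      by rewrite -zE //; exact: zl.
    - by exists (F s1); [exact: (fold_reduction_image l'0 red)|rewrite -zE].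
    - by exists (F s2); [exact: (fold_reduction_image l'0 red)|rewrite -zE].
  have [|w [cw sw wu]] := IHn l' lo hi u (e / 2) _ l'0 l'n zr' cu su e20.
    by apply: leq_trans sl; rewrite -ltnS.
  have [v [cv sv vw]] := fold_reduction_lift l'0 red cw sw e20.
  exists v; split=> // x; have [vT _ _] := sv.
  rewrite zE //; have := le_trans (zigzag_lipschitz _ _ l'0) (vw x).
  by have := wu x; rewrite !ler_norml; lra.
have p0 : 0 < p by case/andP: l0.
have l'0 : positive (q :: l) by case/andP: l0.
have T' := zlength_ge0 l'0.
have TE : zlength (p :: q :: l) = p + zlength (q :: l) by [].
have zE s : 0 <= s ->
    zigzag (p :: q :: l) s = p - zigzag (q :: l) `|s - p|.
  move=> s0; have [sp|ps] := leP s p.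
    have -> : `|s - p| = p - s by rewrite distrC ger0_norm //; lra.
    by rewrite /= sp ifT; lra.
  have h : 0 <= s - p by lra.
  by rewrite ger0_norm // -(zigzag_shift p l'0 h); congr zigzag; lra.
have [zr' lT] : zigzag_range (q :: l) (p - hi) (p - lo) /\ q <= zlength (q :: l).
  split; last first.
    have /zlength_ge0 : positive l by case/andP: l'0.
    by rewrite /zlength /= -/(zlength l); lra.
  have abs s : 0 <= s <= zlength (p :: q :: l) -> 0 <= `|s - p| <= zlength (q :: l).
    rewrite TE => sT; rewrite normr_ge0 /= ler_norml.
    have /zlength_ge0 : positive l by case/andP: l'0.
    by move: sT; rewrite /zlength /= -/(zlength l); lra.
  split.
  - move=> s sT; have := zl (p + s); rewrite TE zigzag_shift //; lra.
  - by exists `|s2 - p|; [exact: abs|rewrite -z2 zE; lra].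
  - by exists `|s1 - p|; [exact: abs|rewrite -z1 zE; lra].
have cu' : continuous (fun x => p - u x).
  by apply: continuous_sub => //; exact: continuous_const.
have [w [cw sw wu]] := IHn (q :: l) _ _ _ (e / 2) sl l'0 isT zr' cu' (spans_opp p su) e20.
(* [vfold_lift] adds a piece at the upper end, whereas [p] is the first piece; hence the coordinate
   is reversed before and after. *)
have cw' : continuous (fun x => zlength (q :: l) - w x).
  by apply: continuous_sub => //; exact: continuous_const.
have sw' := spans_opp (zlength (q :: l)) sw; rewrite subrr subr0 in sw'.
have [|v [cv sv vw]] := vfold_lift cX hX conX iX cw' sw' p0 _ e20; first lra.
exists (fun x => zlength (p :: q :: l) - v x); split.
- by apply: continuous_sub => //; exact: continuous_const.
- have := spans_opp (zlength (p :: q :: l)) sv.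
  by rewrite {2}TE (addrC p) !subrr subr0.
- move=> x; have [vT _ _] := sv; rewrite zE; last by have := vT x; rewrite TE; lra.
  set y := `|_ - p|.
  have yw : `|y - w x| <= e / 2.
    have := vw x; rewrite /vfold /y TE; move: (w x) (v x) (zlength _) => w' v' T.
    have -> : p + T - v' - p = T - v' by lra.
    rewrite !ler_norml; case: (leP 0 (T - v')) => h.
      by rewrite ger0_norm //; minmax; lra.
    by rewrite ltr0_norm //; minmax; lra.
  have := le_trans (zigzag_lipschitz _ _ l'0) yw; have := wu x.
  by move: (zigzag (q :: l)) => z; rewrite !ler_norml; lra.
Qed.

End Zigzags.

(** * From chains to maps to an interval *)

Section ChainMaps.
Variable R : realType.

Definition psum (f : nat -> R) n := \sum_(i < n) f i.

Lemma psumS (f : nat -> R) n : psum f n.+1 = psum f n + f n.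
Proof. by rewrite /psum big_ord_recr. Qed.

Lemma psum_split (f lam : nat -> R) i n : (i < n)%N ->
  (forall j, (j < i)%N -> f j = lam j) ->
  (forall j, (i < j < n)%N -> f j = 0) -> psum f n = psum lam i + f i.
Proof.
move=> + f1; elim: n => // n IHn; rewrite ltnS leq_eqVlt => /orP[/eqP in_|ni] f0.
  by rewrite psumS -in_; congr (_ + _); apply: eq_bigr => j _; apply: f1.
have fn0 : f n = 0 by apply: f0; rewrite ni ltnSn.
rewrite psumS fn0 addr0 IHn // => j /andP[ij jn].
by apply: f0; rewrite ij ltnS ltnW.
Qed.

Lemma psum_le (f : nat -> R) i j : (forall k, 0 <= f k) -> (i <= j)%N ->
  psum f i <= psum f j.
Proof.
move=> f0; elim: j => [|j IHj]; first by rewrite leqn0 => /eqP ->.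
rewrite leq_eqVlt ltnS => /orP[/eqP -> //|/IHj].
by rewrite psumS; have := f0 j; lra.
Qed.

Lemma mkseqS (f : nat -> R) n : mkseq f n.+1 = f 0%N :: mkseq (f \o S) n.
Proof. by rewrite /mkseq /= (iotaDl 1 0 n) -map_comp. Qed.

Lemma zlength_mkseq (f : nat -> R) n : zlength (mkseq f n) = psum f n.
Proof.
elim: n f => [|n IHn] f; first by rewrite /psum big_ord0.
by rewrite mkseqS zlength_cons IHn /psum big_ord_recl.
Qed.

(** The tail of a zigzag occurs with reversed sign, so the induction passes to the sequence of the -
    b (j+1). *)
Lemma zigzag_vertex (b lam : nat -> R) n i : (forall j, 0 < lam j) ->
  (forall j, b j.+1 = b j - (-1) ^+ j * lam j) -> (i <= n)%N ->
  zigzag (mkseq lam n) (psum lam i) = b 0%N - b i.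
Proof.
elim: n i b lam => [|n IHn] [|i] b lam lam0 bS //.
- by rewrite /psum big_ord0 subrr.
- have pos : positive (mkseq lam n.+1) by apply/allP => _ /mapP[j _ ->].
  by rewrite /psum big_ord0 zigzag0 ?subrr.
rewrite ltnS => i_n; rewrite mkseqS.
have -> : psum lam i.+1 = lam 0%N + psum (lam \o S) i by rewrite /psum big_ord_recl.
rewrite zigzag_shift.
- rewrite (IHn i (fun j => - b j.+1) (lam \o S)) //=.
  + by have := bS 0%N; rewrite expr0; lra.
  + by move=> j; rewrite bS exprS /=; lra.
- by apply/allP => _ /mapP[j _ ->]; exact: lam0.
- by apply: sumr_ge0 => j _; apply: ltW; exact: lam0.
Qed.

Variable X : topologicalType.
Hypothesis cX : compact [set: X].
Hypothesis hX : hausdorff_space X.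
Hypothesis conX : connected [set: X].

Lemma continuous_psum (f : nat -> X -> R) n : (forall j, continuous (f j)) ->
  continuous (fun x => psum (f ^~ x) n).
Proof.
move=> cf; elim: n => [|n IHn].
  have -> : (fun x => psum (f ^~ x) 0) = (fun=> 0).
    by apply/funext => x; rewrite /psum big_ord0.
  exact: continuous_const.
have -> : (fun x => psum (f ^~ x) n.+1) = (fun x => psum (f ^~ x) n + f n x).
  by apply/funext => x; rewrite psumS.
exact: continuous_add.
Qed.

(** Indexing by natural numbers lets the neighbour [j.+1] be named without ordinals; covering and
    overlaps only concern indices up to [n]. *)
Definition nat_chain n (U : nat -> set X) :=
  [/\ forall j, open (U j), forall x, exists2 j, (j <= n)%N & U j x &
      forall j k, (j <= n)%N -> (k <= n)%N ->
        (U j `&` U k !=set0) <-> (j <= k.+1)%N /\ (k <= j.+1)%N].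

Lemma chain_nat_chain (C : set (set X)) : chainable X ->
  (forall x, exists U, [/\ C U, open U & U x]) ->
  exists n U, nat_chain n U /\ forall j, exists2 V, C V & U j `<=` V.
Proof.
move=> chX CX; have [|| n [O [[oO OX Oint] refO]]] := chX (C `&` open).
- by move=> U [].
- by apply/seteqP; split=> // x _; have [U [CU oU Ux]] := CX x; exists U.
exists n, (fun j => O (inord j)); split.
  split=> [j //|x|j k jn kn].
    have : (\bigcup_j O j) x by rewrite OX.
    case=> j _ Ojx; exists j; first by rewrite -ltnS.
    by rewrite inord_val.
  by rewrite Oint !inordK // ltnS.
by move=> j; have [V [CV _] OV] := refO (inord j); exists V.
Qed.

(** [v] is a weighted sum of Urysohn functions, the j-th of which rises from 0 to 1 as the chain
    passes from link j to link j+1. At each point at most one of them is strictly between 0 and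
    1. *)
Lemma nat_chain_map n (U : nat -> set X) (lam : nat -> R) :
  nat_chain n U -> (1 < n)%N -> (forall j, 0 <= lam j) ->
  exists v, [/\ continuous v, spans v 0 (psum lam n) &
    forall x, exists i, [/\ (i < n)%N, U i x \/ U i.+1 x &
                            psum lam i <= v x <= psum lam i.+1]].
Proof.
move=> [oU covU intU] n1 lam0.
have inhU j : (j <= n)%N -> U j !=set0.
  move=> jn; have [_] := intU j j jn jn.
  by move=> [|x [Ux _]]; [split; exact: leqnSn|exists x].
have [x0 Ux0] := inhU 0%N isT; have [xn Uxn] := inhU n (leqnn n).
have x0n : x0 <> xn.
  move=> x0n; have [+ _] := intU n 0%N (leqnn n) isT.
  move=> []; first by exists xn; split=> //; rewrite -x0n.
  by rewrite leqNgt n1.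
have closedN k : closed (~` U k) by apply: open_closedC.
have closed1 (x : X) : closed [set x].
  by apply: compact_closed => //; exact: compact_set1.
(* Adding the points [x0] and [xn] makes [v] attain both end values; 1 < n keeps them distinct, as
   links 0 and [n] are then disjoint. *)
pose P j := (\bigcap_(k in [set k | (j < k <= n)%N]) ~` U k) `|` [set x0].
pose Q j := (\bigcap_(k in [set k | (k <= j)%N]) ~` U k) `|` [set xn].
have cP j : closed (P j) by apply: closedU => //; exact: closed_bigI.
have cQ j : closed (Q j) by apply: closedU => //; exact: closed_bigI.
have PQ j : (j < n)%N -> P j `&` Q j = set0.
  move=> jn; apply/seteqP; split=> // x [[Px|Px] [Qx|Qx]].
  - have [k kn Ukx] := covU x.
    have [kj|jk] := leqP k j; first exact: (Qx k).
    by apply: (Px k) => //=; rewrite jk.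
  - by move: Px; rewrite Qx => /(_ n) []; rewrite /= ?jn ?leqnn.
  - by move: Qx; rewrite Px => /(_ 0%N) [].
  - by case: x0n; rewrite -Px -Qx.
have gP j : exists g : X -> R, [/\ continuous g, forall x, 0 <= g x <= 1,
    (j < n)%N -> forall x, P j x -> g x = 0 &
    (j < n)%N -> forall x, Q j x -> g x = 1].
  have [jn|_] := ltnP j n; last first.
    exists (fun=> 0); split=> //; first exact: continuous_const.
    by move=> x; lra.
  have := (@normal_separatorP R X).1 (compact_normal hX cX) _ _ (cP j) (cQ j) (PQ j jn).
  move=> /(@uniform_separatorP X R)[g [cg g01 gP gQ]]; exists g; split=> //.
  - by move=> x; have := g01 (g x); rewrite /= in_itv /=; apply; exists x.
  - by move=> _ x Px; apply: gP; exists x.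
  - by move=> _ x Qx; apply: gQ; exists x.
have [g gE] := choice gP.
pose v x := psum (fun j => lam j * g j x) n.
have loc x : exists i, [/\ (i < n)%N, U i x \/ U i.+1 x &
                            v x = psum lam i + lam i * g i x].
  have [k0 k0n Uk0] := covU x.
  have exk : exists k, (k <= n)%N && (x \in U k) by exists k0; rewrite k0n mem_set.
  case: (ex_minnP exk) => k /andP[kn /set_mem Ukx] kmin.
  have low j : (j < k)%N -> ~ U j x.
    move=> jk Ujx; suff : (k <= j)%N by rewrite leqNgt jk.
    by apply: kmin; rewrite (leq_trans (ltnW jk) kn) mem_set.
  have high j : (k.+1 < j <= n)%N -> ~ U j x.
    move=> /andP[kj jn] Ujx; have [+ _] := intU j k jn kn.
    by move=> []; [exists x|rewrite leqNgt kj].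
  (* There are n + 1 links but only [n] pieces, so the last link is assigned to piece n - 1. *)
  have [i [i_n ik Uix]] : exists i, [/\ (i < n)%N,
      i = k \/ (i.+1 = k /\ k = n) & U i x \/ U i.+1 x].
    move: kn; rewrite leq_eqVlt => /orP[/eqP kn|kn]; last first.
      by exists k; split=> //; left.
    exists n.-1; rewrite -kn in n1 *.
    by rewrite prednK ?(ltn_trans _ n1) //; split=> //; right.
  exists i; split=> //; apply: psum_split => // j.
    move=> ji; have [_ _ _ g1] := gE j; rewrite g1 ?mulr1 //.
    + exact: ltn_trans i_n.
    + by left=> m /= mj; apply: low; lia.
  move=> /andP[ij jn]; have [_ _ g0 _] := gE j; rewrite g0 ?mulr0 //.
  by left=> m /= jmn; apply: high; lia.
have cv : continuous v.
  by apply: continuous_psum => j; apply: continuous_scale; have [] := gE j.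
have loc' x : exists i, [/\ (i < n)%N, U i x \/ U i.+1 x &
                             psum lam i <= v x <= psum lam i.+1].
  have [i [i_n Uix vx]] := loc x; exists i; split=> //.
  have [_ /(_ x)/andP[g0 g1] _ _] := gE i.
  rewrite vx psumS; have := mulr_ge0 (lam0 i) g0.
  have := ler_wpM2l (lam0 i) g1; lra.
exists v; split=> //; split.
- move=> x; have [i [i_n _ /andP[h1 h2]]] := loc' x.
  have h3 : psum lam i.+1 <= psum lam n by exact: psum_le.
  have h4 : psum lam 0 <= psum lam i by exact: psum_le.
  by move: h4; rewrite /psum big_ord0 -!/(psum _ _); lra.
- exists x0; rewrite /v /psum big1 // => j _.
  by have [_ _ g0 _] := gE j; rewrite g0 ?mulr0 //; right.
- exists xn; rewrite /v /psum; apply: eq_bigr => j _.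
  by have [_ _ _ g1] := gE j; rewrite g1 ?mulr1 //; right.
Qed.

End ChainMaps.

Section MetricFacts.
Variables (R : realType) (X : topologicalType).

Definition compatible_metric (d : X -> X -> R) :=
  [/\ forall x y, d x y = 0 <-> x = y,
      forall x y, d x y = d y x,
      forall x y z, d x z <= d x y + d y z &
      forall x (A : set X),
        nbhs x A <-> exists2 e : R, 0 < e & [set y | d x y < e] `<=` A].

Variable d : X -> X -> R.
Hypothesis dX : compatible_metric d.

Lemma dist_refl x : d x x = 0.
Proof. by have [d0 _ _ _] := dX; exact/d0. Qed.

Lemma dist_sym x y : d x y = d y x.
Proof. by have [_ dC _ _] := dX. Qed.

Lemma dist_triangle y x z : d x z <= d x y + d y z.
Proof. by have [_ _ dT _] := dX. Qed.

Lemma dist_ge0 x y : 0 <= d x y.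
Proof. by have := dist_triangle y x x; rewrite dist_refl (dist_sym y); lra. Qed.

Lemma dist_gt0 x y : x <> y -> 0 < d x y.
Proof.
have [d0 _ _ _] := dX; move=> xy; rewrite lt_neqAle dist_ge0 andbT eq_sym.
by apply/eqP => /d0.
Qed.

Lemma nbhs_dist x e : 0 < e -> nbhs x [set y | d x y < e].
Proof. by have [_ _ _ dN] := dX; move=> e0; apply/dN; exists e. Qed.

Lemma dist_nbhs x (A : set X) : nbhs x A -> 
  exists2 e : R, 0 < e & [set y | d x y < e] `<=` A.
Proof. by have [_ _ _ dN] := dX; move=> /dN. Qed.

Lemma compatible_metric_hausdorff : hausdorff_space X.
Proof.
move=> p q pq; apply: contrapT => /dist_gt0 dpq.
have e0 : 0 < d p q / 2 by lra.
have [z [/= pz qz]] := pq _ _ (nbhs_dist p e0) (nbhs_dist q e0).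
by have := dist_triangle z p q; rewrite (dist_sym z); lra.
Qed.

End MetricFacts.

Lemma spans_close (R : realType) (X : topologicalType) (u v : X -> R) a b p q e :
  (forall x, `|u x - v x| <= e) -> spans u a b -> spans v p q ->
  `|a - p| <= e /\ `|b - q| <= e.
Proof.
move=> uv [uab [x1 u1] [x2 u2]] [vpq [y1 v1] [y2 v2]].
have := uv x1; have := uv x2; have := uv y1; have := uv y2.
have := vpq x1; have := vpq x2; have := uab y1; have := uab y2.
by rewrite u1 u2 v1 v2 !ler_norml; lra.
Qed.

(** Two links [m], [m'] at index distance at most 2 have a common neighbour [r], so three links lead
    from one point to the other. *)
Lemma chain_midpoint (i k m m' n : nat) : (i <= k.+1 -> k <= i.+1 ->
  m = i \/ m = i.+1 -> m' = k \/ m' = k.+1 -> m <= n -> m' <= n ->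
  exists r, [/\ r <= n, m <= r.+1, r <= m.+1, m' <= r.+1 & r <= m'.+1])%N.
Proof.
move=> ik ki mi m'k mn m'n; have [mm|mm] := leqP m m'.
  have [mm'|mm'] := leqP m' m.+1; first by exists m; split; lia.
  by exists m.+1; split; lia.
have [mm'|mm'] := leqP m m'.+1; first by exists m; split; lia.
by exists m'.+1; split; lia.
Qed.

Section FineMaps.
Variables (R : realType) (X : topologicalType) (d : X -> X -> R).
Hypothesis dX : compatible_metric d.
Hypothesis cX : compact [set: X].
Hypothesis chX : chainable X.
Variables (pt1 pt2 : X).
Hypothesis pt12 : pt1 <> pt2.

Let hX : hausdorff_space X := compatible_metric_hausdorff dX.

Lemma exists_spans (u : X -> R) : continuous u -> exists a b, spans u a b.
Proof.
move=> cu; have cu' : {within [set: X], continuous u} by exact: continuous_subspaceT.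
have X0 : [set: X] !=set0 by exists pt1.
have [x1 _ x1P] := compact_EVT_min X0 cX cu'.
have [x2 _ x2P] := compact_EVT_max X0 cX cu'.
exists (u x1), (u x2); split; [|by exists x1|by exists x2].
by move=> x; rewrite x1P ?x2P // in_setT.
Qed.

Lemma small_chain (v : X -> R) (e eta : R) : continuous v -> 0 < e -> 0 < eta ->
  exists n U, [/\ nat_chain n U, (1 < n)%N &
    forall j y z, U j y -> U j z -> d y z < e /\ `|v y - v z| <= eta].
Proof.
move=> cv e0 eta0; have D := dist_gt0 dX pt12.
(* Links smaller than half of [d pt1 pt2] force at least three links, since [pt1] and [pt2] cannot
   lie in two links that meet. *)
pose e' := Num.min e (d pt1 pt2 / 2).
have e'0 : 0 < e' by rewrite /e'; minmax; lra.
pose C := [set U : set X | forall y z, U y -> U z -> d y z < e' /\ `|v y - v z| <= eta].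
have [x|n [U [nc Ufine]]] := chain_nat_chain (C := C) chX.
  have h2 : 0 < eta / 2 by lra.
  have e2 : 0 < e' / 2 by lra.
  have nv : nbhs x [set y | `|v x - v y| < eta / 2].
    by have /cvgrPdist_lt/(_ _ h2) := cv x.
  have [V [oV Vx] VV] : exists2 V, open_nbhs x V &
      V `<=` [set y | d x y < e' / 2] `&` [set y | `|v x - v y| < eta / 2].
    have : nbhs x ([set y | d x y < e' / 2] `&` [set y | `|v x - v y| < eta / 2]).
      by apply: filterI => //; exact: nbhs_dist.
    by rewrite nbhsE => -[V oV VA]; exists V.
  exists V; split=> // y z /VV[/= dy vy] /VV[/= dz vz]; split.
    by have := dist_triangle dX x y z; rewrite (dist_sym dX y x); lra.
  by move: vy vz; rewrite !ltr_norml ler_norml; lra.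
exists n, U; split=> //; last first.
  move=> j y z Uy Uz; have [V CV UV] := Ufine j.
  have [+ ?] := CV y z (UV _ Uy) (UV _ Uz); split=> //.
  by move: a; rewrite /e'; minmax; lra.
have fine j y z : U j y -> U j z -> d y z < d pt1 pt2 / 2.
  move=> Uy Uz; have [V CV UV] := Ufine j.
  by have [] := CV y z (UV _ Uy) (UV _ Uz); rewrite /e'; minmax; lra.
have [_ covU intU] := nc.
rewrite ltnNge; apply/negP => n1.
have [j jn Uj] := covU pt1; have [k kn Uk] := covU pt2.
have [_] := intU j k jn kn; move=> []; first by lia.
move=> z [jz kz]; have := fine _ _ _ Uj jz; have := fine _ _ _ kz Uk.
by have := dist_triangle dX z pt1 pt2; lra.
Qed.

(** The e-maps of continuum theory, with fibres of diameter below [e]; the modulus [mu], which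
    exists for continuous [w] by compactness, is kept as data. *)
Definition eps_map (e mu : R) (w : X -> R) :=
  0 < mu /\ forall y z, `|w y - w z| <= mu -> d y z < e.

(** Along a fine chain [v] changes little from link to link. Its values, perturbed so as to fall and
    rise alternately, are the vertices of the zigzag, and [w] sends the links to its pieces in
    order. *)
Lemma zigzag_fine_map (v : X -> R) e eta : continuous v -> 0 < e -> 0 < eta ->
  exists l b0 w mu, [/\ positive l, l != [::], continuous w,
    spans w 0 (zlength l) & eps_map e mu w /\
    forall x, `|b0 - zigzag l (w x) - v x| <= eta].
Proof.
(* 11 = 6 + 3 + 2: length of a piece, distance of [beta] from [v], distance of [b] from [beta]. *)
move=> cv e0 eta0; pose h := eta / 11.
have h0 : 0 < h by rewrite /h; lra.
have e4 : 0 < e / 4 by lra.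
have [n [U [nc n1 Ufine]]] := small_chain cv e4 h0.
have [_ covU intU] := nc.
have xP j : exists x, (j <= n)%N -> U j x.
  have [jn|_] := leqP j n; last by exists pt1.
  have [_] := intU j j jn jn.
  by move=> []; [split; exact: leqnSn|move=> x [Ux _]; exists x].
have [p pU] := choice xP.
have overlap j k : (j <= n)%N -> (k <= n)%N -> (j <= k.+1)%N -> (k <= j.+1)%N ->
    exists2 x, U j x & U k x.
  by move=> jn kn jk kj; have [_] := intU j k jn kn; case=> [//|x [? ?]]; exists x.
pose beta j := v (p (minn j n)).
pose sg j : R := (-1) ^+ j.
(* Neighbouring [beta] differ by at most 2h, so alternating shifts by 2h make [b] strictly
   alternate, with steps between 2h and 6h. *)
pose b j := beta j + sg j * (2 * h).
pose lam j := sg j * (beta j - beta j.+1) + 4 * h.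
have sgE j : sg j = 1 \/ sg j = -1.
  by rewrite /sg -signr_odd; case: (odd j); [right|left].
have dbeta j : `|beta j - beta j.+1| <= 2 * h.
  have [jn|nj] := ltnP j n; rewrite /beta.
    rewrite (minn_idPl (ltnW jn)) (minn_idPl jn).
    have [x Ux U'x] := overlap j j.+1 (ltnW jn) jn (leqW (leqnSn j)) (leqnn _).
    have [_ h1] := Ufine _ _ _ (pU j (ltnW jn)) Ux.
    have [_ h2] := Ufine _ _ _ (pU j.+1 jn) U'x.
    by move: h1 h2; rewrite !ler_norml; lra.
  by rewrite (minn_idPr nj) (minn_idPr (leqW nj)) subrr normr0; lra.
have lamb j : 2 * h <= lam j <= 6 * h.
  have := dbeta j; rewrite /lam ler_norml.
  by case: (sgE j) => ->; lra.
have lam0 j : 0 < lam j by have := lamb j; lra.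
have bS j : b j.+1 = b j - sg j * lam j.
  rewrite /b /lam {1}/sg exprS -/(sg j).
  by case: (sgE j) => ->; lra.
have [w [cw sw wloc]] := nat_chain_map cX hX nc n1 (fun j => ltW (lam0 j)).
have posl : positive (mkseq lam n) by apply/allP => _ /mapP[j _ ->].
exists (mkseq lam n), (b 0%N), w, h; rewrite zlength_mkseq; split=> //.
  by case: (n) n1.
split; last first.
  move=> x; have [i [i_n Uix /andP[w1 w2]]] := wloc x.
  have zv := zigzag_vertex lam0 bS (ltnW i_n).
  have := zigzag_lipschitz (w x) (psum lam i) posl; rewrite zv.
  have ww : `|w x - psum lam i| <= 6 * h.
    by move: w2; rewrite psumS ler_norml; have := lamb i; lra.
  move=> /le_trans /(_ ww).
  have bv : `|beta i - v x| <= 3 * h.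
    have beta_near j : (j <= n)%N -> U j x -> `|beta j - v x| <= h.
      move=> jn Ux; rewrite /beta (minn_idPl jn).
      by have [] := Ufine _ _ _ (pU j jn) Ux.
    case: Uix => [/(beta_near _ (ltnW i_n))|/(beta_near _ i_n)].
      by rewrite !ler_norml; lra.
    by have := dbeta i; rewrite !ler_norml; lra.
  have bb : `|b i - beta i| <= 2 * h.
    by rewrite /b ler_norml; case: (sgE i) => ->; lra.
  have -> : eta = 11 * h by rewrite /h; lra.
  by move: bv bb; rewrite !ler_norml; lra.
split=> // y z wyz.
have [i [i_n Uiy /andP[y1 y2]]] := wloc y.
have [k [k_n Ukz /andP[z1 z2]]] := wloc z.
(* The modulus [h] is less than every piece, so [y] and [z] lie over equal or adjacent pieces. *)
have close i' k' : psum lam i' <= psum lam k' + h -> (i' <= k')%N.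
  move=> ik; have [//|ki] := leqP i' k'.
  have : psum lam k'.+1 <= psum lam i' by apply: psum_le => // j; exact: ltW.
  by rewrite psumS; have := lamb k'; lra.
have ik : (i <= k.+1)%N by apply: close; move: wyz; rewrite ler_norml; lra.
have ki : (k <= i.+1)%N by apply: close; move: wyz; rewrite ler_norml; lra.
have [m [mn Umy mi]] : exists m, [/\ (m <= n)%N, U m y & m = i \/ m = i.+1].
  by case: Uiy => ?; [exists i; split=> //; [exact: ltnW|left]|exists i.+1; split=> //; right].
have [m' [m'n Um'z m'k]] : exists m, [/\ (m <= n)%N, U m z & m = k \/ m = k.+1].
  by case: Ukz => ?; [exists k; split=> //; [exact: ltnW|left]|exists k.+1; split=> //; right].
have [r [rn mr rm m'r rm']] := chain_midpoint ik ki mi m'k mn m'n.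
have [s1 ms1 rs1] := overlap m r mn rn mr rm.
have [s2 ms2 rs2] := overlap m' r m'n rn m'r rm'.
have [d1 _] := Ufine _ _ _ Umy ms1; have [d2 _] := Ufine _ _ _ rs1 rs2.
have [d3 _] := Ufine _ _ _ ms2 Um'z.
have := dist_triangle dX s1 y z; have := dist_triangle dX s2 s1 z.
lra.
Qed.

End FineMaps.

(** * Approximate homogeneity *)

Lemma continuous_normr (R : realType) (X : topologicalType) (u : X -> R) :
  continuous u -> continuous (fun x => `|u x|).
Proof. by move=> cu x; apply: cvg_norm; exact: cu. Qed.

Lemma natSinv_small (R : realType) (e : R) : 0 < e ->
  exists n : nat, forall m, (n <= m)%N -> m.+1%:R^-1 < e.
Proof.
move=> e0; exists (Num.bound e^-1) => m nm.
rewrite -[ltRHS]invrK ltf_pV2 ?posrE ?invr_gt0 //.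
have /archi_boundP/lt_le_trans -> // : 0 <= e^-1 by rewrite invr_ge0 ltW.
by rewrite ler_nat; exact: leq_trans (leqnSn _).
Qed.

(** * Homeomorphisms as limits of shrinking closed relations *)

Section LimitRelations.
Variables (R : realType) (X : topologicalType) (d : X -> X -> R).
Hypothesis dX : compatible_metric d.
Hypothesis cX : compact [set: X].

Lemma dist_continuous (f : X -> X) :
  (forall x e, 0 < e -> exists2 U, nbhs x U & forall y, U y -> d (f x) (f y) < e) ->
  continuous f.
Proof.
move=> fP x V /(dist_nbhs dX)[e e0 eV]; have [U xU UP] := fP x e e0.
suff: nbhs x (f @^-1` V) by [].
by apply: (filterS _ xU) => y /UP /eV.
Qed.

(** Fibres over points near [x] are close together, uniformly in [x] up to the choice of [U]; this
    gives both uniqueness and continuity of the limit. *)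
Definition shrinking (H : nat -> X -> X -> Prop) :=
  forall e : R, 0 < e -> exists n, forall x, exists2 U, nbhs x U &
    forall x' y y', U x' -> H n x y -> H n x' y' -> d y y' < e.

Lemma limit_map (H : nat -> X -> X -> Prop) :
  (forall n x y, H n.+1 x y -> H n x y) ->
  (forall n x, exists y, H n x y) ->
  (forall n x, closed [set y | H n x y]) ->
  shrinking H ->
  exists phi, [/\ continuous phi, forall n x, H n x (phi x) &
    forall x y, (forall n, H n x y) -> y = phi x].
Proof.
move=> Hnest Htot Hcl Hsmall.
have nest m n x y : (m <= n)%N -> H n x y -> H m x y.
  move=> /subnKC <-; elim: (n - m)%N => [|k IHk]; first by rewrite addn0.
  by rewrite addnS => /Hnest.
have ex x : exists y, forall n, H n x y.
  apply: contrapT => no.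
  pose P := [set S : set X | exists n, forall y, S y -> ~ H n x y].
  have [|A B [m mA] [n nB]|A B AB [n nB]|y _|n nP] := @compact_ind X setT P cX.
  - by exists 0%N.
  - exists (maxn m n) => y [Ay|By] Hy.
      by apply: (mA y Ay); apply: nest Hy; exact: leq_maxl.
    by apply: (nB y By); apply: nest Hy; exact: leq_maxr.
  - by exists n => y /AB; exact: nB.
  - have /existsNP[n nH] : ~ forall n, H n x y by move=> Hy; apply: no; exists y.
    exists (~` [set y | H n x y]); last by exists n.
    by apply: open_nbhs_nbhs; split=> //; exact/closed_openC.
  - by have [y /nP] := Htot n x; apply.
have [phi phiP] := choice ex.
have uniq x y : (forall n, H n x y) -> y = phi x.
  move=> Hy; apply: contrapT => /(dist_gt0 dX) e0.
  have [n /(_ x)[U xU UP]] := Hsmall _ e0.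
  by have := UP x y (phi x) (nbhs_singleton xU) (Hy n) (phiP x n); rewrite ltxx.
exists phi; split=> //.
apply: dist_continuous => x e e0; have [n /(_ x)[U xU UP]] := Hsmall e e0.
by exists U => // y Uy; exact: UP Uy (phiP x n) (phiP y n).
Qed.

(** The relations and their converses have limit maps, and uniqueness of the limits makes these
    mutually inverse. *)
Lemma limit_homeomorphism (H : nat -> X -> X -> Prop) :
  (forall n x y, H n.+1 x y -> H n x y) ->
  (forall n x, exists y, H n x y) -> (forall n y, exists x, H n x y) ->
  (forall n x, closed [set y | H n x y]) -> (forall n y, closed [set x | H n x y]) ->
  shrinking H -> shrinking (fun n x y => H n y x) ->
  exists phi, homeomorphism phi /\ forall n x, H n x (phi x).
Proof.
move=> Hnest tot1 tot2 cl1 cl2 sm1 sm2.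
have [phi [cphi phiH phiU]] := limit_map Hnest tot1 cl1 sm1.
have [psi [cpsi psiH psiU]] :=
  limit_map (fun n x y => Hnest n y x) tot2 cl2 sm2.
exists phi; split=> //; split=> //; exists psi; split=> // x.
  by apply/esym/psiU => n; exact: phiH.
by apply/esym/phiU => n; exact: psiH.
Qed.

End LimitRelations.

Section ApproximateHomogeneity.
Variables (R : realType) (X : topologicalType) (d : X -> X -> R).
Hypothesis dX : compatible_metric d.
Hypothesis cX : compact [set: X].
Hypothesis conX : connected [set: X].
Hypothesis chX : chainable X.
Hypothesis iX : hereditarily_indecomposable X.
Variables (pt1 pt2 : X).
Hypothesis pt12 : pt1 <> pt2.

Let hX : hausdorff_space X := compatible_metric_hausdorff dX.

(** One stage of the back-and-forth, standing for the relation |u x - v y| <= eta; equal images make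
    it total in both directions. *)
Record matched (u v : X -> R) (eta : R) := Matched {
  matchedl : continuous u;
  matchedr : continuous v;
  matched_gt0 : 0 < eta;
  matched_span : exists a b, [/\ a < b, spans u a b & spans v a b] }.

Definition coarsens (u v : X -> R) (eta : R) (u' v' : X -> R) (eta' : R) :=
  forall x y, `|u' x - v' y| <= eta' -> `|u x - v y| <= eta.

Lemma matched_sym u v eta : matched u v eta -> matched v u eta.
Proof. by case=> cu cv e0 [a [b [ab su sv]]]; split=> //; exists a, b. Qed.

(** [v] is nearly a zigzag of an e-map [w]; [u], rescaled to the range of that zigzag, is lifted
    over the same zigzag, and its lift is matched with [w]. *)
Lemma refine_right u v eta e : matched u v eta -> 0 < e ->
  exists u' v' eta', [/\ matched u' v' eta', coarsens u v eta u' v' eta' &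
                         eps_map d e (3 * eta') v'].
Proof.
move=> [cu cv eta0 [al [be [albe su sv]]]] e0.
(* 24 = 11 + 11 + 1 + 1: approximation of [v], rescaling of [u], lifting, and the new tolerance
   [eta']. *)
pose h := eta / 24.
have h0 : 0 < h by rewrite /h; lra.
have etaE : eta = 24 * h by rewrite /h; lra.
clearbody h.
have h11 : 0 < 11 * h by lra.
have [l [b0 [w [mu [lpos l0 cw sw [[mu0 fw] wv]]]]]] :=
  zigzag_fine_map dX cX chX pt12 cv e0 h11.
have lT : 0 < zlength l.
  case: l lpos l0 {sw wv} => // p l /andP[p0 /zlength_ge0 lT] _.
  by rewrite zlength_cons; lra.
have czw : continuous (fun x => b0 - zigzag l (w x)).
  apply: continuous_sub; first exact: continuous_const.
  move=> x; apply/cvgrPdist_lt => r r0.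
  have /cvgrPdist_lt/(_ _ r0) := cw x; apply: filterS => y.
  exact: le_lt_trans (zigzag_lipschitz _ _ lpos).
have [a [b szw]] := exists_spans cX pt1 czw.
have [al_a be_b] := spans_close wv szw sv.
have [||u1 [cu1 su1 u1u]] := spans_rescale cu su albe (spans_le szw) (e := 11 * h).
- by rewrite distrC.
- by rewrite distrC.
have cu2 : continuous (fun x => b0 - u1 x).
  by apply: continuous_sub => //; exact: continuous_const.
have su2 := spans_opp b0 su1.
have zr : zigzag_range l (b0 - b) (b0 - a).
  have [zab [xa xaE] [xb xbE]] := szw; have [wT [x0 w0] [x1 w1]] := sw.
  split.
  - move=> s sT; have [|z <-] := connected_ivt (x := x0) (y := x1) (c := s) conX cw.
      by rewrite w0 w1.
    by have := zab z; lra.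
  - by exists (w xb); rewrite // -xbE; lra.
  - by exists (w xa); rewrite // -xaE; lra.
have [u' [cu' su' u'u]] := zigzag_lift cX hX conX iX lpos l0 zr cu2 su2 h0.
pose eta' := Num.min h (mu / 3).
exists u', w, eta'; split.
- split=> //; first by rewrite /eta'; minmax; lra.
  by exists 0, (zlength l).
- move=> x y xy; have xyh : `|u' x - w y| <= h.
    by apply: le_trans xy _; rewrite /eta'; minmax; lra.
  have := le_trans (zigzag_lipschitz _ _ lpos) xyh.
  have := u'u x; have := wv y; have := u1u x; rewrite etaE.
  move: (u1 x) (u x) (v y) (zigzag _ _) (zigzag _ _) => r1 r2 r3 r4 r5.
  by rewrite !ler_norml; lra.
- split; first by rewrite /eta'; minmax; lra.
  move=> y z yz; apply: fw; apply: le_trans yz _; rewrite /eta'; minmax; lra.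
Qed.

(** Points related to nearby points have values differing by at most three tolerances, whence the
    factor 3 in [refine_right]. Its second use, with the roles exchanged, refines the other side. *)
Lemma refine_both u v eta e : matched u v eta -> 0 < e ->
  exists u' v' eta', [/\ matched u' v' eta', coarsens u v eta u' v' eta',
    (forall x, exists2 U, nbhs x U & forall x' y y', U x' ->
      `|u' x - v' y| <= eta' -> `|u' x' - v' y'| <= eta' -> d y y' < e) &
    (forall y, exists2 U, nbhs y U & forall y' x x', U y' ->
      `|u' x - v' y| <= eta' -> `|u' x' - v' y'| <= eta' -> d x x' < e)].
Proof.
move=> m e0.
have [u1 [v1 [eta1 [m1 c1 [f10 f1]]]]] := refine_right m e0.
have [v2 [u2 [eta2 [m2 c2 [f20 f2]]]]] := refine_right (matched_sym m1) e0.
have c2' x y : `|u2 x - v2 y| <= eta2 -> `|u1 x - v1 y| <= eta1.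
  by rewrite distrC => /c2; rewrite distrC.
have near (f : X -> R) r (x : X) : continuous f -> 0 < r ->
    nbhs x [set y | `|f x - f y| < r].
  by move=> cf r0; have /cvgrPdist_lt/(_ _ r0) := cf x.
exists u2, v2, eta2; split.
- exact: matched_sym.
- by move=> x y /c2' /c1.
- move=> x; exists [set x' | `|u1 x - u1 x'| < eta1].
    by apply: near; [case: m1|lra].
  move=> x' y y' /= xx' /c2' xy /c2' xy'; apply: f1.
  by move: xx' xy xy'; rewrite ltr_norml !ler_norml; lra.
- move=> y; exists [set y' | `|v2 y - v2 y'| < eta2].
    by apply: near; [case: m2|lra].
  move=> y' x x' /= yy' xy xy'; apply: f2.
  by move: yy' xy xy'; rewrite ltr_norml !ler_norml; lra.
Qed.

Lemma approximate_homogeneity (u v : X -> R) eta : matched u v eta ->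
  exists h, homeomorphism h /\ forall x, `|u x - v (h x)| <= eta.
Proof.
move=> m0.
pose S := {p : (X -> R) * (X -> R) * R | matched p.1.1 p.1.2 p.2}.
pose rel (p : S) x y := `|(sval p).1.1 x - (sval p).1.2 y| <= (sval p).2.
have step (np : nat * S) : exists q : S, [/\
    forall x y, rel q x y -> rel np.2 x y,
    (forall x, exists2 U, nbhs x U & forall x' y y', U x' ->
      rel q x y -> rel q x' y' -> d y y' < np.1.+1%:R^-1) &
    (forall y, exists2 U, nbhs y U & forall y' x x', U y' ->
      rel q x y -> rel q x' y' -> d x x' < np.1.+1%:R^-1)].
  have e0 : 0 < np.1.+1%:R^-1 :> R by rewrite invr_gt0.
  have [u' [v' [eta' [m' c s1 s2]]]] := refine_both (svalP np.2) e0.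
  by exists (exist _ (u', v', eta') m'); split.
have [F FP] := choice step.
pose st := fix st n : S := if n is n'.+1 then F (n', st n') else exist _ (u, v, eta) m0.
have stS n : st n.+1 = F (n, st n) by [].
have tot n : (forall x, exists y, rel (st n) x y) /\ forall y, exists x, rel (st n) x y.
  rewrite /rel; case: (st n) => -[[u' v'] eta'] [/= cu cv eta0 [a [b [ab su sv]]]].
  have ivt (f g : X -> R) : continuous g -> spans f a b -> spans g a b ->
      forall x, exists y, g y = f x.
    move=> cg [fab _ _] [_ [x0 g0] [x1 g1]] x.
    by apply: (@connected_ivt _ _ g x0 x1) => //; rewrite g0 g1.
  split=> x.
    by have [y yE] := ivt u' v' cv su sv x; exists y; rewrite yE subrr normr0 ltW.
  by have [y yE] := ivt v' u' cu sv su x; exists y; rewrite yE subrr normr0 ltW.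
have [||||||| phi [hphi phiP]] := @limit_homeomorphism R X d dX cX (fun n => rel (st n)).
- by move=> n x y; rewrite stS; have [+ _ _] := FP (n, st n); exact.
- by move=> n x; have [+ _] := tot n; exact.
- by move=> n y; have [_ +] := tot n; exact.
- move=> n x; rewrite /rel; case: (st n) => -[[u' v'] eta'] [/= cu cv _ _].
  apply: (closed_sublevel eta' (u := fun y => `|u' x - v' y|)).
  by apply: continuous_normr; apply: continuous_sub => //; exact: continuous_const.
- move=> n y; rewrite /rel; case: (st n) => -[[u' v'] eta'] [/= cu cv _ _].
  apply: (closed_sublevel eta' (u := fun x => `|u' x - v' y|)).
  by apply: continuous_normr; apply: continuous_sub => //; exact: continuous_const.
- move=> e /natSinv_small[n /(_ n (leqnn n)) ne]; exists n.+1 => x.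
  have [_ /(_ x)[U xU UP] _] := FP (n, st n); exists U => // x' y y' Ux' h1 h2.
  exact: lt_trans (UP _ _ _ Ux' h1 h2) ne.
- move=> e /natSinv_small[n /(_ n (leqnn n)) ne]; exists n.+1 => y.
  have [_ _ /(_ y)[U yU UP]] := FP (n, st n); exists U => // y' x x' Uy' h1 h2.
  exact: lt_trans (UP _ _ _ Uy' h1 h2) ne.
by exists phi; split=> // x; exact: (phiP 0%N).
Qed.

End ApproximateHomogeneity.

(** * Every point is an end point *)

Section Spirals.
Variables (R : realType) (X : topologicalType).
Hypothesis cX : compact [set: X].
Hypothesis hX : hausdorff_space X.
Hypothesis iX : hereditarily_indecomposable X.

Definition lipschitz1 (t : R -> R) := forall s s', `|t s - t s'| <= `|s - s'|.

Definition sublevel_component (w : X -> R) b x :=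
  connected_component [set y | w y <= b] x.

(* Either the component of [x] in [w <= b] stays above [a + 1], and [a] can be
   raised, or it contains the component of [x] in [w >= a + 2].  In the second
   case the induction hypothesis applies upside down, that is to [- w], and the
   resulting path from [0] is prolonged by one piece going up from [a + 2] to [b]. *)
Lemma spiral n (w : X -> R) a b x (O : set X) : continuous w ->
  a < w x <= b -> b - a <= n%:R ->
  sublevel_component w b x `<=` [set y | a < w y] ->
  open O -> sublevel_component w b x `<=` O ->
  exists (G : set X) (v : X -> R) (t : R -> R) (l : R), [/\
    [/\ open G, sublevel_component w b x `<=` G, G `<=` O &
        forall y, rim G y -> b < w y],
    [/\ continuous v, forall y, 0 <= v y <= l, v x = 0 & forall y, ~ G y -> v y = l],
    lipschitz1 t, t l = b & forall y, G y -> `|t (v y) - w y| <= 3].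
Proof.
elim: n w a b O => [|n IHn] w a b O cw wx ban Ca oO CO; first by lra.
rewrite -natr1 in ban.
pose C := sublevel_component w b x.
have Cx : C x by apply: connected_component_refl => /=; lra.
have Cb : C `<=` [set y | w y <= b] by exact: connected_component_sub.
have [G [oG CG GO rG]] : exists G, [/\ open G, C `<=` G,
    G `<=` O `&` [set y | a < w y] `&` [set y | w y < b + 1] &
    rim G `&` [set y | w y <= b] = set0].
  apply: (cut_wire cX hX R) => //.
  - exact: closed_sublevel.
  - by move=> /=; lra.
  - apply: openI; last exact: open_sublevel.
    by apply: openI => //; exact: open_superlevel.
  - move=> y Cy; split; [split; [exact: CO|exact: Ca]|].
    by have := Cb y Cy; rewrite /=; lra.
have rimG y : rim G y -> b < w y.
  by move=> ry; rewrite ltNge; apply/negP => wy; apply: (absurd_set0 rG (x := y)).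
have GO' : G `<=` O by move=> y /GO[[]].
have Ga y : G y -> a < w y by move=> /GO[[]].
have Gb y : G y -> w y < b + 1 by move=> /GO[].
have [wxa|awx] := leP (w x) (a + 2).
  pose l := b - w x; have l0 : 0 <= l by rewrite /l; lra.
  pose v y := if y \in G then clip 0 l (w y - w x) else l.
  exists G, v, (fun s => w x + s), l; split=> //.
  - split.
    + apply: glue_continuous => //; last first.
        by move=> y /rimG ?; apply: clip_above => //; rewrite /l; lra.
      * exact: continuous_const.
      * by apply: continuous_clip; apply: continuous_sub => //; exact: continuous_const.
    + by move=> y; rewrite /v; case: ifP => _; [exact: clip_bounds|rewrite l0 lexx].
    + rewrite /v ifT; last by rewrite inE; exact: CG.
      by rewrite subrr clip_below.
    + by move=> y nGy; rewrite /v ifF //; apply/negbTE; rewrite notin_setE.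
  - by move=> s s'; rewrite opprD addrACA subrr add0r.
  - by rewrite /l; lra.
  - move=> y Gy; have wa := Ga y Gy; have wb := Gb y Gy; rewrite /v mem_set //.
    have : `|clip 0 l (w y - w x) - (w y - w x)| <= 2.
      by apply: clip_near => //; rewrite /l; lra.
    by rewrite !ler_norml; lra.
have [Ca1|nCa1] := pselect (C `<=` [set y | a + 1 < w y]).
  by apply: (IHn w (a + 1) b O) => //; lra.
have [y0 Cy0 wy0] : exists2 y, C y & w y <= a + 1.
  apply: contrapT => no; apply: nCa1 => y Cy /=; rewrite ltNge; apply/negP => wy.
  by apply: no; exists y.
have cw' : continuous (fun y => - w y) by exact: continuous_opp.
pose D := sublevel_component (fun y => - w y) (- (a + 2)) x.
have ab2 : a + 2 <= b by lra.
have Dx : D x by apply: connected_component_refl => /=; lra.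
have DC : D `<=` C.
  have [CD|//] := components_nested cX iX (closed_sublevel b cw)
    (closed_sublevel (- (a + 2)) cw') Cx Dx.
  by have := connected_component_sub (CD _ Cy0); rewrite /=; lra.
(* The interval from - (b + 1) to - (a + 2) is shorter by one unit; its lower end is admissible
   because w <= b on [C], which contains [D]. *)
have [||||G' [v' [t' [l' [[oG' DG' G'G rG'] [cv' v'l v'x v'off] t'1 t'l t'v]]]]] :=
    IHn (fun y => - w y) (- (b + 1)) (- (a + 2)) G cw' _ _ _ oG.
- by lra.
- by lra.
- by move=> y /DC /Cb /=; lra.
- by move=> y /DC /CG.
(* [e] is the new last piece: zero on [G'] and on its rim, where w < a + 2, and growing with [w] up
   to [b] outside. *)
pose e1 y := if y \in G then clip (a + 2) b (w y) - (a + 2) else b - (a + 2).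
pose e y := if y \in G' then 0 else e1 y.
have ce1 : continuous e1.
  apply: glue_continuous => //.
  - apply: continuous_sub; last exact: continuous_const.
    exact: continuous_clip.
  - exact: continuous_const.
  - by move=> y /rimG ?; rewrite clip_above // ltW.
have ce : continuous e.
  apply: glue_continuous => //; first exact: continuous_const.
  move=> y ry; have wy : w y < a + 2 by have := rG' _ ry; lra.
  rewrite /e1; case: ifPn => [_|]; first by rewrite clip_below ?subrr // ltW.
  rewrite notin_setE => nGy; have : rim G y.
    by split=> //; case: ry => [+ _]; apply: closureS.
  by move=> /rimG; lra.
have e0 y : 0 <= e y <= b - (a + 2).
  rewrite /e /e1; case: ifP => _; first by lra.
  by case: ifP => _; last lra; have := clip_bounds (w y) ab2; lra.
have l'0 : 0 <= l' by have := v'l x; lra.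
pose t s := if s <= l' then - t' s else a + 2 + (s - l').
have tE s : l' <= s -> t s = a + 2 + (s - l').
  move=> ls; rewrite /t; case: ifPn => // sl.
  have -> : s = l' by lra.
  by rewrite t'l; lra.
exists G, (fun y => v' y + e y), t, (l' + (b - (a + 2))); split=> //.
- split.
  + exact: continuous_add.
  + by move=> y; have := v'l y; have := e0 y; lra.
  + by rewrite v'x /e ifT ?addr0 // inE; exact: DG'.
  + move=> y nGy; rewrite v'off; last by move=> /G'G.
    rewrite /e ifF; last by apply/negbTE; rewrite notin_setE => /G'G.
    by rewrite /e1 ifF //; apply/negbTE; rewrite notin_setE.
- move=> s s'; rewrite /t.
  case: ifPn => sl; case: ifPn => sl'.
  + by have := t'1 s s'; rewrite -opprD normrN.
  + have := t'1 s l'; rewrite t'l => /ler_normlP[].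
    have -> : `|s - l'| = l' - s by rewrite distrC ger0_norm; lra.
    have -> : `|s - s'| = s' - s by rewrite distrC ger0_norm; lra.
    by move=> *; rewrite ler_norml; lra.
  + have := t'1 s' l'; rewrite t'l => /ler_normlP[].
    have -> : `|s' - l'| = l' - s' by rewrite distrC ger0_norm; lra.
    have -> : `|s - s'| = s - s' by rewrite ger0_norm; lra.
    by move=> *; rewrite ler_norml; lra.
  + by have -> : a + 2 + (s - l') - (a + 2 + (s' - l')) = s - s' by lra.
- by rewrite tE; lra.
- move=> y Gy; have [G'y|nG'y] := pselect (G' y).
    have := t'v y G'y; have := v'l y.
    rewrite /e mem_set // addr0 /t => /andP[_ ->].
    by rewrite -normrN opprD !opprK.
  rewrite v'off // /e ifF; last by apply/negbTE; rewrite notin_setE.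
  rewrite /e1 mem_set //; have := clip_bounds (w y) ab2 => cb.
  have : `|clip (a + 2) b (w y) - w y| <= 2.
    by apply: clip_near => //; have := Ga y Gy; have := Gb y Gy; lra.
  by rewrite tE; [rewrite !ler_norml|]; lra.
Qed.

Hypothesis conX : connected [set: X].

Lemma spiral_everywhere (w : X -> R) p q x : continuous w -> spans w p q ->
  exists (v : X -> R) (t : R -> R) (l : R), [/\ continuous v, forall y, 0 <= v y <= l, v x = 0,
    lipschitz1 t & forall y, `|t (v y) - w y| <= 3].
Proof.
move=> cw [wpq _ _].
have [n nE] : exists n, q - (p - 1) <= n%:R.
  exists (Num.bound `|q - (p - 1)|); apply: le_trans (ler_norm _) _.
  by apply: ltW; apply: archi_boundP.
have Cx : sublevel_component w q x = setT.
  rewrite /sublevel_component (_ : [set y | w y <= q] = setT).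
    exact: connected_component_id.
  by apply/seteqP; split=> // y _ /=; have := wpq y; lra.
have [|||||G [v [t [l [[_ CG _ _] [cv vl vx _] t1 _ tv]]]]] :=
  @spiral n w (p - 1) q x setT cw.
- by have := wpq x; lra.
- by [].
- by move=> y _ /=; have := wpq y; lra.
- exact: openT.
- by [].
exists v, t, l; split=> // y; apply: tv; apply: CG.
by rewrite Cx.
Qed.

End Spirals.

(** * Joint approximation of two homeomorphisms *)

Lemma max0_lipschitz (R : realType) (p q : R) :
  `|Num.max p 0 - Num.max q 0| <= `|p - q|.
Proof.
have : p - q <= `|p - q| by exact: ler_norm.
have : q - p <= `|p - q| by rewrite distrC; exact: ler_norm.
by rewrite ler_norml; minmax; lra.
Qed.

Lemma max0_difference (R : realType) (p q : R) : 0 <= p -> 0 <= q ->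
  p = 0 \/ q = 0 -> p = Num.max (p - q) 0 /\ q = Num.max (- (p - q)) 0.
Proof. by move=> p0 q0; minmax; lra. Qed.

Lemma lipschitz_continuous (R : realType) (b : R -> R) k : 0 <= k ->
  (forall s s', `|b s - b s'| <= k * `|s - s'|) -> continuous b.
Proof.
move=> k0 bk s; apply/cvgrPdist_lt => r r0.
have rk : 0 < r / (k + 1) by apply: divr_gt0; lra.
exists (r / (k + 1)) => // s' /= ss'; apply: le_lt_trans (bk _ _) _.
by move: ss'; rewrite ltr_pdivlMr; [have := normr_ge0 (s - s'); nra|lra].
Qed.

Section Transitivity.
Variables (R : realType) (X : topologicalType) (d : X -> X -> R).
Hypothesis dX : compatible_metric d.
Hypothesis cX : compact [set: X].
Hypothesis conX : connected [set: X].
Hypothesis chX : chainable X.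
Hypothesis iX : hereditarily_indecomposable X.
Variables (pt1 pt2 : X).
Hypothesis pt12 : pt1 <> pt2.

Let hX : hausdorff_space X := compatible_metric_hausdorff dX.

Lemma lebesgue_number (Q : X -> X -> Prop) :
  (forall x : X, exists2 U, nbhs x U & forall y z, U y -> U z -> Q y z) ->
  exists2 e : R, 0 < e & forall y z, d y z < e -> Q y z.
Proof.
move=> loc.
pose P := [set S : set X | exists2 e : R, 0 < e & forall y z, S y -> d y z < e -> Q y z].
have [|A B [a a0 aP] [b b0 bP]|A B AB [b b0 bP]|x _|e e0 eP] := @compact_ind X setT P cX.
- by exists 1.
- exists (Num.min a b); first by minmax.
  move=> y z [Ay|By] yz.
    by apply: aP => //; move: yz; minmax; lra.
  by apply: bP => //; move: yz; minmax; lra.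
- by exists b => // y z /AB; exact: bP.
- have [U /(dist_nbhs dX)[e e0 eU] UQ] := loc x.
  have e2 : 0 < e / 2 by lra.
  exists [set y | d x y < e / 2]; first exact: nbhs_dist.
  exists (e / 2) => // y z /= xy yz; apply: UQ; apply: eU => /=; first by lra.
  by have := dist_triangle dX y x z; lra.
- by exists e => // y z; exact: eP.
Qed.

Lemma uniform_continuity (u : X -> R) e : continuous u -> 0 < e ->
  exists2 r : R, 0 < r & forall y z, d y z < r -> `|u y - u z| <= e.
Proof.
move=> cu e0; apply: lebesgue_number => x.
have e2 : 0 < e / 2 by lra.
exists [set y | `|u x - u y| < e / 2].
  by have /cvgrPdist_lt/(_ _ e2) := cu x.
by move=> y z /=; rewrite !ltr_norml ler_norml; lra.
Qed.

Lemma uniform_continuity_map (f : X -> X) e : continuous f -> 0 < e ->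
  exists2 r : R, 0 < r & forall y z, d y z < r -> d (f y) (f z) < e.
Proof.
move=> cf e0; apply: lebesgue_number => x.
have e2 : 0 < e / 2 by lra.
exists (f @^-1` [set y | d (f x) y < e / 2]); first by apply: cf; exact: nbhs_dist.
move=> y z /= fy fz; have := dist_triangle dX (f x) (f y) (f z).
by rewrite (dist_sym dX (f y) (f x)); lra.
Qed.

Lemma exists_eps_map e : 0 < e -> exists (w : X -> R) l mu,
  [/\ continuous w, spans w 0 l, 0 < l & eps_map d e mu w].
Proof.
(* Only the fine map [w] is wanted, so the function to be approximated by a zigzag is constant. *)
move=> e0; have c0 : continuous (fun _ : X => 0 : R) by exact: continuous_const.
have [l [b0 [w [mu [lpos l0 cw sw [fw _]]]]]] :=
  zigzag_fine_map dX cX chX pt12 c0 e0 ltr01.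
exists w, (zlength l), mu; split=> //.
case: l lpos l0 {sw} => // p l /andP[p0 /zlength_ge0 lT] _.
by rewrite zlength_cons; lra.
Qed.

(** An e-map is stretched and replaced by the coordinate [v] of a spiral starting at [x]; since t o
    v is close to the stretched map, [v] is as fine. *)
Lemma exists_eps_map_endpoint x e : 0 < e -> exists (w : X -> R) l mu,
  [/\ continuous w, spans w 0 l, 0 < l, w x = 0 & eps_map d e mu w].
Proof.
move=> e0; pose e' := Num.min e (d pt1 pt2).
have D := dist_gt0 dX pt12.
have e'0 : 0 < e' by rewrite /e'; minmax.
have [w [l [mu [cw sw l0 [mu0 fw]]]]] := exists_eps_map e'0.
(* 7 = 3 + 1 + 3: if [v] differs by at most 1, the stretched map differs by at most 7, hence [w] by
   at most [mu]. *)
have cw7 : continuous (fun y => 7 / mu * w y) by exact: continuous_scale.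
have [p [q sw7]] := exists_spans cX pt1 cw7.
have [v [t [m [cv vm vx t1 tv]]]] := spiral_everywhere cX hX iX conX x cw7 sw7.
have vE y z : `|v y - v z| <= 1 -> d y z < e'.
  move=> vyz; apply: fw.
  have h1 := le_trans (t1 (v y) (v z)) vyz.
  have h2 : `|7 / mu * w y - 7 / mu * w z| <= 7.
    by have := tv y; have := tv z; move: h1; rewrite !ler_norml; lra.
  have h3 : 0 < 7 / mu by apply: divr_gt0; lra.
  move: h2; rewrite -mulrBr normrM (gtr0_norm h3) -ler_pdivlMl //.
  by rewrite invf_div; lra.
have [a [b [vab [xa vxa] [xb vxb]]]] := exists_spans cX pt1 cv.
have a0 : a = 0 by have := vm xa; have := vab x; rewrite vx vxa; lra.
have b0 : 0 < b.
  rewrite ltNge; apply/negP => b0.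
  have : d pt1 pt2 < e'.
    by apply: vE; have := vab pt1; have := vab pt2; rewrite ler_norml; lra.
  by rewrite /e'; minmax; lra.
exists v, b, 1; split=> //.
  by split; [rewrite -a0|exists x|exists xb].
split; first by lra.
by move=> y z /vE; rewrite /e'; minmax; lra.
Qed.

(** Otherwise every point moves by at least some e > 0. For an e-map [w] the difference w (f x) - w
    x changes sign, and at a zero of it the point moves by less than [e]. *)
Lemma fixed_point (f : X -> X) : continuous f -> exists x, f x = x.
Proof.
move=> cf; apply: contrapT => nofix.
have [e e0 eP] : exists2 e : R, 0 < e & forall y, e <= d y (f y).
  pose P := [set S : set X | exists2 e : R, 0 < e & forall y, S y -> e <= d y (f y)].
  have [|A B [a a0 aP] [b b0 bP]|A B AB [b b0 bP]|x _|e e0 eP] :=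
      @compact_ind X setT P cX.
  - by exists 1.
  - exists (Num.min a b); first by minmax.
    by move=> y [/aP|/bP]; minmax; lra.
  - by exists b => // y /AB; exact: bP.
  - have fx : 0 < d x (f x).
      by apply: (dist_gt0 dX) => xE; apply: nofix; exists x.
    have e3 : 0 < d x (f x) / 3 by lra.
    exists ([set y | d x y < d x (f x) / 3] `&` f @^-1` [set y | d (f x) y < d x (f x) / 3]).
      apply: filterI; first exact: nbhs_dist.
      by apply: cf; exact: nbhs_dist.
    exists (d x (f x) / 3) => // y [/= h1 h2].
    have := dist_triangle dX y x (f x); have := dist_triangle dX (f y) y (f x).
    by rewrite (dist_sym dX (f y) (f x)); lra.
  - by exists e => // y; exact: eP.
have [w [l [mu [cw [wl [x0 w0] [x1 w1]] l0 [mu0 fw]]]]] := exists_eps_map e0.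
have cwf : continuous (fun x => w (f x) - w x).
  by apply: continuous_sub => // x; apply: continuous_comp; [exact: cf|exact: cw].
have [|z zE] := connected_ivt (x := x1) (y := x0) (c := 0) conX cwf.
  by rewrite w0 w1; have := wl (f x0); have := wl (f x1); lra.
have : d z (f z) < e.
  by apply: fw; rewrite distrC zE normr0; lra.
by have := eP z; lra.
Qed.

(* McShane's formula [a s = min_y (phi y + K |s - phi1 y|)], rescaled. *)
Lemma factor_through (phi phi1 : X -> R) l l1 x mu e :
  continuous phi -> continuous phi1 -> spans phi 0 l -> spans phi1 0 l1 ->
  phi x = 0 -> phi1 x = 0 -> 0 < e -> e < l -> 0 < mu ->
  (forall y z, `|phi1 y - phi1 z| <= mu -> `|phi y - phi z| <= e) ->
  exists (a : R -> R) K, [/\ 0 <= K,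
    forall s s', `|a s - a s'| <= K * `|s - s'|, a 0 = 0,
    (forall s, 0 <= s <= l1 -> 0 <= a s <= l) /\
      (exists2 s, 0 <= s <= l1 & a s = l) &
    forall y, `|a (phi1 y) - phi y| <= 2 * e].
Proof.
move=> cphi cphi1 [phil _ [xl phixl]] sphi1 phix phi1x e0 el mu0 phie.
have [phi1l [x0 phi10] [x1 phi11]] := sphi1.
(* With this slope a point whose [phi1] value is more than [mu] away contributes at least [l], so it
   cannot push the minimum below [phi y]. *)
pose K0 := l / mu; have K00 : 0 < K0 by apply: divr_gt0; lra.
have minP s : exists m : R, (forall y, m <= phi y + K0 * `|s - phi1 y|) /\
    exists y, m = phi y + K0 * `|s - phi1 y|.
  have [|m [m' [mP [y yE] _]]] :=
      @exists_spans R X cX pt1 (fun y => phi y + K0 * `|s - phi1 y|).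
    apply: continuous_add => //; apply: continuous_scale.
    apply: continuous_normr; apply: continuous_sub => //.
    exact: continuous_const.
  exists m; split; last by exists y.
  by move=> z; have /andP[] := mP z.
have [a0 a0P] := choice minP.
have a0lip s s' : a0 s - a0 s' <= K0 * `|s - s'|.
  have [_ [y ->]] := a0P s'; have [/(_ y) h _] := a0P s.
  have := ler_wpM2l (ltW K00) (ler_distD s' s (phi1 y)); lra.
have a0_ge0 s : 0 <= a0 s.
  have [_ [y ->]] := a0P s; have := phil y.
  by have := mulr_ge0 (ltW K00) (normr_ge0 (s - phi1 y)); lra.
have a0_le y : a0 (phi1 y) <= phi y.
  have [/(_ y) + _] := a0P (phi1 y); by rewrite subrr normr0 mulr0 addr0.
have a0_near y : phi y - e <= a0 (phi1 y).
  have [_ [z ->]] := a0P (phi1 y).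
  have [yz|yz] := leP `|phi1 y - phi1 z| mu.
    have := phie _ _ yz; rewrite ler_norml.
    by have := mulr_ge0 (ltW K00) (normr_ge0 (phi1 y - phi1 z)); lra.
  have := ler_wpM2l (ltW K00) (ltW yz); rewrite /K0 divfK ?gt_eqF //.
  by have := phil y; have := phil z; lra.
have ca0 : continuous (fun y => a0 (phi1 y)).
  move=> y; apply/cvgrPdist_lt => r r0.
  have rK : 0 < r / K0 by exact: divr_gt0.
  have /cvgrPdist_lt/(_ _ rK) := cphi1 y; apply: filterS => z yz.
  have : K0 * `|phi1 y - phi1 z| < r by rewrite mulrC -ltr_pdivlMr.
  have := a0lip (phi1 y) (phi1 z); have := a0lip (phi1 z) (phi1 y).
  by rewrite (distrC (phi1 z)) ltr_norml; lra.
have [p [m [am _ [ym amy]]]] := exists_spans cX pt1 ca0.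
(* The maximum [m] is between l - e and [l]. Scaling by l / m makes it exactly [l] and keeps a 0 =
   0, at the cost of a second [e]. *)
have ml : l - e <= m by have := am xl; have := a0_near xl; rewrite phixl; lra.
have m_l : m <= l by have := a0_le ym; have := phil ym; rewrite amy; lra.
have m0 : 0 < m by lra.
have lm : 0 <= l / m by apply: divr_ge0; lra.
have lmm : l / m * m = l by rewrite divfK // gt_eqF.
have onto s : 0 <= s <= l1 -> exists y, phi1 y = s.
  move=> sl; apply: (connected_ivt (x := x0) (y := x1) conX cphi1).
  by rewrite phi10 phi11.
exists (fun s => l / m * a0 s), (l / m * K0); split.
- by apply: mulr_ge0 => //; exact: ltW.
- move=> s s'; rewrite -mulrBr normrM (ger0_norm lm) -(mulrA (l / m)).
  apply: (ler_wpM2l lm).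
  by have := a0lip s s'; have := a0lip s' s; rewrite (distrC s') ler_norml; lra.
- have := a0_le x; rewrite phi1x phix => h.
  by have -> : a0 0 = 0; [have := a0_ge0 0; lra|rewrite mulr0].
- split.
    move=> s /onto[y <-]; rewrite mulr_ge0 //=.
    have /(ler_wpM2l lm) : a0 (phi1 y) <= m by have := am y; lra.
    by rewrite lmm.
  exists (phi1 ym); first exact: phi1l.
  by rewrite amy.
- move=> y; have am' : a0 (phi1 y) <= m by have := am y; lra.
  have h1 : a0 (phi1 y) <= l / m * a0 (phi1 y).
    rewrite -[leLHS]mul1r ler_wpM2r //.
    by rewrite ler_pdivlMr // mul1r.
  have h2 : l / m * a0 (phi1 y) - a0 (phi1 y) <= l - m.
    have -> : l / m * a0 (phi1 y) - a0 (phi1 y) = (l / m - 1) * a0 (phi1 y) by lra.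
    have -> : l - m = (l / m - 1) * m by rewrite mulrBl mul1r lmm.
    by apply: ler_wpM2l => //; rewrite subr_ge0 ler_pdivlMr // mul1r.
  have := a0_le y; have := a0_near y; rewrite ler_norml; lra.
Qed.

(* The common end point [0] of the two intervals represents a fixed point of [f],
   so that models of two homeomorphisms can be glued at [0]. *)
Lemma interval_model (f : X -> X) e : homeomorphism f -> 0 < e ->
  exists (a a' : R -> R) l l1 delta, [/\
    [/\ 0 < l, 0 < l1 & 0 < delta],
    [/\ continuous a, continuous a', a 0 = 0 & a' 0 = 0],
    (forall s, 0 <= s <= l1 -> 0 <= a s <= l /\ 0 <= a' s <= l),
    (exists2 s, 0 <= s <= l1 & a s = l) /\
      (exists2 s, 0 <= s <= l1 & a' s = l) &
    forall r : X -> R, continuous r -> spans r 0 l1 ->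
      exists theta, homeomorphism theta /\ forall h : X -> X,
        (forall y, `|a (r (h y)) - a' (r y)| <= delta) ->
        forall y, d (theta (h y)) (f (theta y)) < e].
Proof.
move=> [cf [g [cg fg gf]]] e0; have [x fx] := fixed_point cf.
have [phi [l [mu [cphi sphi l0 phix [mu0 fphi]]]]] := exists_eps_map_endpoint x e0.
(* 7 = 2 + 2 + 1 + 1 + 1: two factorizations, the hypothesis on [h], and [theta] used twice. *)
pose eta := Num.min (mu / 7) (l / 2).
have eta0 : 0 < eta by rewrite /eta; minmax; lra.
have etal : eta < l by rewrite /eta; minmax; lra.
have eta7 : 7 * eta <= mu by rewrite /eta; minmax; lra.
clearbody eta.
have cphif : continuous (fun y => phi (f y)).
  by move=> y; apply: continuous_comp; [exact: cf|exact: cphi].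
have sphif : spans (fun y => phi (f y)) 0 l.
  have [phil [x0 p0] [x1 p1]] := sphi; split=> //.
    by exists (g x0); rewrite gf.
  by exists (g x1); rewrite gf.
have phifx : phi (f x) = 0 by rewrite fx.
have [r1 r10 r1P] := uniform_continuity cphi eta0.
have [r2 r20 r2P] := uniform_continuity cphif eta0.
have r0 : 0 < Num.min r1 r2 by minmax.
have [phi1 [l1 [mu1 [cphi1 sphi1 l10 phi1x [mu10 fphi1]]]]] :=
  exists_eps_map_endpoint x r0.
have [|a [K [K0 aK a0 [al [sa sal asl]] aphi]]] := factor_through cphi cphi1 sphi sphi1
  phix phi1x eta0 etal mu10.
  by move=> y z /fphi1 yz; apply: r1P; move: yz; minmax; lra.
have [|a' [K' [K'0 a'K a'0 [a'l [sa' sa'l a'sl]] a'phi]]] := factor_through cphif cphi1 sphif sphi1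
  phifx phi1x eta0 etal mu10.
  by move=> y z /fphi1 yz; apply: r2P; move: yz; minmax; lra.
exists a, a', l, l1, eta; split=> //.
- by split=> //; [exact: lipschitz_continuous aK|exact: lipschitz_continuous a'K].
- by move=> s sl; split; [exact: al|exact: a'l].
- by split; [exists sa|exists sa'].
move=> r cr sr.
(* An error [k] in the argument becomes at most [eta] under both Lipschitz maps. *)
pose k := eta / (K + K' + 1).
have KK : 0 < K + K' + 1 by lra.
have k0 : 0 < k by exact: divr_gt0.
have kK : (K + K' + 1) * k = eta by rewrite /k mulrC divfK // gt_eqF.
have m : matched r phi1 k by split=> //; exists 0, l1.
have [theta [htheta thetaP]] := approximate_homogeneity dX cX conX chX iX pt12 m.
exists theta; split=> // h hP y; apply: fphi.
have h1 := aphi (theta (h y)); have h2 := a'phi (theta y).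
have h3 := hP y.
have h4 : `|a (r (h y)) - a (phi1 (theta (h y)))| <= eta.
  apply: le_trans (aK _ _) _; apply: le_trans (ler_wpM2l K0 (thetaP (h y))) _.
  by rewrite -kK ler_wpM2r ?ltW //; lra.
have h5 : `|a' (r y) - a' (phi1 (theta y))| <= eta.
  apply: le_trans (a'K _ _) _; apply: le_trans (ler_wpM2l K'0 (thetaP y)) _.
  by rewrite -kK ler_wpM2r ?ltW //; lra.
apply: le_trans eta7.
move: h1 h2 h3 h4 h5.
move: (phi _) (phi _) (a _) (a _) (a' _) (a' _) => q1 q2 q3 q4 q5 q6.
by rewrite !ler_norml; lra.
Qed.

(* The glued model [c s = a (max s 0) - b (max (- s) 0)] acts as the model of [f]
   on the positive and as that of [g] on the negative half line. *)
Lemma joint_approximation (f g : X -> X) e : homeomorphism f -> homeomorphism g ->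
  0 < e -> exists h theta1 theta2 : X -> X, [/\ homeomorphism h,
    homeomorphism theta1, homeomorphism theta2,
    forall y, d (theta1 (h y)) (f (theta1 y)) < e &
    forall y, d (theta2 (h y)) (g (theta2 y)) < e].
Proof.
move=> hf hg e0.
have [a [a' [l [l1 [da [[l0 l10 da0] [ca ca' a0 a'0] al [aon a'on] aP]]]]]] :=
  interval_model hf e0.
have [b [b' [m [m1 [db [[m0 m10 db0] [cb cb' b0 b'0] bm [bon b'on] bP]]]]]] :=
  interval_model hg e0.
have [w0 [k [mu [cw0 sw0 k0 _]]]] := exists_eps_map e0.
have [|||w [cw sw _]] := spans_rescale (p := - m1) (q := l1)
    (e := m1 + l1 + k) cw0 sw0 k0.
- by lra.
- by rewrite ler_norml; lra.
- by rewrite ler_norml; lra.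
pose pos y := Num.max (w y) 0; pose neg y := Num.max (- w y) 0.
have cpos : continuous pos by apply: continuous_maxr => //; exact: continuous_const.
have cneg : continuous neg.
  apply: continuous_maxr; [exact: continuous_opp|exact: continuous_const].
have [wml [xm wxm] [xl wxl]] := sw.
have spos : spans pos 0 l1.
  split; first by move=> y; have := wml y; rewrite /pos; minmax; lra.
    by exists xm; rewrite /pos wxm; minmax; lra.
  by exists xl; rewrite /pos wxl; minmax; lra.
have sneg : spans neg 0 m1.
  split; first by move=> y; have := wml y; rewrite /neg; minmax; lra.
    by exists xl; rewrite /neg wxl; minmax; lra.
  by exists xm; rewrite /neg wxm; minmax; lra.
have posE y : 0 <= w y -> pos y = w y /\ neg y = 0.
  by move=> wy; rewrite /pos /neg (elimT max_idPl) // (elimT max_idPr) // oppr_le0.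
have negE y : w y <= 0 -> pos y = 0 /\ neg y = - w y.
  by move=> wy; rewrite /pos /neg (elimT max_idPr) // (elimT max_idPl) // oppr_ge0.
have pos_neg y : pos y = 0 \/ neg y = 0.
  by have [/negE[]|/ltW/posE[]] := leP (w y) 0; [left|right].
have join (p q : R -> R) : continuous p -> continuous q -> p 0 = 0 -> q 0 = 0 ->
    (forall s, 0 <= s <= l1 -> 0 <= p s <= l) ->
    (forall s, 0 <= s <= m1 -> 0 <= q s <= m) ->
    (exists2 s, 0 <= s <= l1 & p s = l) -> (exists2 s, 0 <= s <= m1 & q s = m) ->
    let c y := p (pos y) - q (neg y) in
    [/\ continuous c, spans c (- m) l,
       forall y, p (pos y) = Num.max (c y) 0 & forall y, q (neg y) = Num.max (- c y) 0].
  move=> cp cq p0 q0 pl qm [sp spl psp] [sq sqm qsq] c.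
  have [pl1 _ _] := spos; have [nm1 _ _] := sneg.
  have pq0 y : 0 <= p (pos y) /\ 0 <= q (neg y).
    by have /andP[] := pl _ (pl1 y); have /andP[] := qm _ (nm1 y).
  have pq y : p (pos y) = 0 \/ q (neg y) = 0.
    by case: (pos_neg y) => ->; [left|right].
  split.
  - apply: continuous_sub => y.
      by apply: continuous_comp; [exact: cpos|exact: cp].
    by apply: continuous_comp; [exact: cneg|exact: cq].
  - split.
    + by move=> y; have := pl _ (pl1 y); have := qm _ (nm1 y); rewrite /c; lra.
    + have [|y wy] := connected_ivt (x := xm) (y := xl) (c := - sq) conX cw.
        by rewrite wxm wxl; lra.
      have [|pE nE] := negE y; first by rewrite wy; lra.
      by exists y; rewrite /c nE pE wy opprK p0 qsq sub0r.
    + have [|y wy] := connected_ivt (x := xm) (y := xl) (c := sp) conX cw.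
        by rewrite wxm wxl; lra.
      have [|pE nE] := posE y; first by rewrite wy; lra.
      by exists y; rewrite /c nE pE wy q0 psp subr0.
  - by move=> y; have [] := max0_difference (pq0 y).1 (pq0 y).2 (pq y).
  - by move=> y; have [] := max0_difference (pq0 y).1 (pq0 y).2 (pq y).
have [cc sc c1 c2] := join a b ca cb a0 b0 (fun s sl => (al s sl).1)
  (fun s sl => (bm s sl).1) aon bon.
have [cc' sc' c1' c2'] := join a' b' ca' cb' a'0 b'0 (fun s sl => (al s sl).2)
  (fun s sl => (bm s sl).2) a'on b'on.
have [theta1 [htheta1 P1]] := aP pos cpos spos.
have [theta2 [htheta2 P2]] := bP neg cneg sneg.
(* The resulting [h] serves both models at once: positive and negative parts, which are 1-Lipschitz,
   recover the model of [f] and that of [g] from the glued one. *)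
have mat : matched (fun y => a' (pos y) - b' (neg y))
    (fun y => a (pos y) - b (neg y)) (Num.min da db).
  split=> //; first by minmax.
  by exists (- m), l; split=> //; lra.
have [h [hh hP]] := approximate_homogeneity dX cX conX chX iX pt12 mat.
exists h, theta1, theta2; split=> //.
- apply: P1 => y; rewrite c1 c1'; apply: le_trans (max0_lipschitz _ _) _.
  by rewrite distrC; apply: le_trans (hP y) _; rewrite ge_min lexx.
- apply: P2 => y; rewrite c2 c2'; apply: le_trans (max0_lipschitz _ _) _.
  rewrite -opprD normrN distrC.
  by apply: le_trans (hP y) _; rewrite ge_min lexx orbT.
Qed.

End Transitivity.

(** * A dense conjugacy class *)

Lemma homeomorphism_comp_fun (X : topologicalType) (f g : X -> X) :
  homeomorphism f -> homeomorphism g -> homeomorphism (f \o g).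
Proof. by move=> hf hg; exact: (homeomorphism_comp (mk_homeo hf) (mk_homeo hg)). Qed.

Lemma homeomorphism_inverse (X : topologicalType) (f : X -> X) :
  homeomorphism f -> exists g, [/\ homeomorphism g, cancel f g & cancel g f].
Proof.
move=> [cf [g [cg fg gf]]]; exists g; split=> //.
by split=> //; exists f.
Qed.

Section DenseConjugates.
Variables (R : realType) (X : topologicalType) (d : X -> X -> R).
Hypothesis dX : compatible_metric d.
Hypothesis cX : compact [set: X].

Lemma continuous_dist z : continuous (d z).
Proof.
move=> y; apply/cvgrPdist_lt => e e0.
have := nbhs_dist dX y e0; apply: filterS => y' /= yy'.
have := dist_triangle dX y z y'; have := dist_triangle dX y' z y.
by rewrite (dist_sym dX y' y) ltr_norml; lra.
Qed.

Lemma finite_net (r : R) : 0 < r ->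
  exists s : seq X, forall x, exists2 y, y \in s & d x y < r.
Proof.
move=> r0.
pose P := [set S : set X | exists s : seq X, forall x, S x -> exists2 y, y \in s & d x y < r].
have [|A B [s sP] [t tP]|A B AB [s sP]|x _|s sP] := @compact_ind X setT P cX.
- by exists [::].
- exists (s ++ t) => x [/sP|/tP] [y ys xy]; exists y => //; rewrite mem_cat ys //.
  exact: orbT.
- by exists s => x /AB; exact: sP.
- exists [set y | d x y < r]; first exact: nbhs_dist.
  by exists [:: x] => y /= xy; exists x; rewrite ?mem_head // dist_sym.
- by exists s => x; exact: sP.
Qed.

(** A code (k, m, list) prescribes a modulus of continuity and, for each point of the m-th net, a
    point of the k-th net near its image. Homeomorphisms fitting the same code differ by less than 4
    / (k + 1), so one choice per realized code is enough. *)
Lemma countable_dense_homeomorphisms (pt : X) :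
  exists F : nat -> X -> X, (forall n, homeomorphism (F n)) /\
    forall f (e : R), homeomorphism f -> 0 < e ->
      exists n, forall x, d (F n x) (f x) < e.
Proof.
have r0 k : 0 < k.+1%:R^-1 :> R by rewrite invr_gt0.
have [net netP] := choice (fun k => finite_net (r0 k)).
pose fits (c : nat * nat * seq nat) (f : X -> X) :=
  (forall x y, d x y < c.1.2.+1%:R^-1 -> d (f x) (f y) < c.1.1.+1%:R^-1) /\
  forall y, y \in net c.1.2 ->
    d (f y) (nth pt (net c.1.1) (nth 0%N c.2 (index y (net c.1.2)))) < c.1.1.+1%:R^-1.
have ex (n : nat) : exists f : X -> X, homeomorphism f /\
    forall c, unpickle n = Some c ->
      (exists2 g, homeomorphism g & fits c g) -> fits c f.
  case E : (unpickle n) => [c|]; last first.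
    by exists id; split=> //; exact: homeomorphism_id.
  have [[g hg cg]|no] := pselect (exists2 g, homeomorphism g & fits c g).
    by exists g; split=> // _ [<-].
  by exists id; split=> [|_ [<-]//]; exact: homeomorphism_id.
have [F FP] := choice ex.
exists F; split=> [n|f e hf e0]; first by have [] := FP n.
have e4 : 0 < e / 4 by lra.
have [k /(_ k (leqnn k)) ke] := natSinv_small e4.
have [cf _] := hf.
have [r r_0 rP] := uniform_continuity_map dX cX cf (r0 k).
have [m /(_ m (leqnn m)) mr] := natSinv_small r_0.
have exz y : exists x, x \in net k /\ d (f y) x < k.+1%:R^-1.
  by have [x xn fx] := netP k (f y); exists x.
have [z zP] := choice exz.
pose c := (k, m, [seq index (z y) (net k) | y <- net m]).
have cf' : fits c f.
  split=> [x y xy|y yn] /=; first by apply: rP; exact: lt_trans mr.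
  have [zn fz] := zP y.
  by rewrite (nth_map y) ?index_mem // nth_index // nth_index.
have [_ /(_ c (pickleK c))[]] := FP (pickle c); first by exists f.
move=> /= Fmod Fnet; have [/= fmod fnet] := cf'.
exists (pickle c) => x; have [y yn xy] := netP m x.
have := Fmod _ _ xy; have := fmod _ _ xy; have := Fnet y yn; have := fnet y yn.
set w := nth pt _ _; set G := F _.
have := dist_triangle dX (G y) (G x) (f x); have := dist_triangle dX w (G y) (f x).
have := dist_triangle dX (f y) w (f x).
rewrite (dist_sym dX w (f y)) (dist_sym dX (f y) (f x)); move: ke.
by move: (k.+1%:R^-1) => q; lra.
Qed.

Hypothesis conX : connected [set: X].
Hypothesis chX : chainable X.
Hypothesis iX : hereditarily_indecomposable X.
Variables (pt1 pt2 : X).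
Hypothesis pt12 : pt1 <> pt2.

Definition nearly_conjugate (phi g : X -> X) (e : R) :=
  exists2 theta, homeomorphism theta & forall y, d (theta (phi y)) (g (theta y)) < e.

(** Conjugating the joint approximation by its first conjugator brings it close to [psi], and it
    remains conjugate to an approximation of [g]. *)
Lemma push_conjugate (psi g : X -> X) (e : R) : homeomorphism psi ->
  homeomorphism g -> 0 < e -> exists psi', [/\ homeomorphism psi',
    forall y, d (psi' y) (psi y) < e & nearly_conjugate psi' g e].
Proof.
move=> hpsi hg e0.
have [h [t1 [t2 [hh ht1 ht2 P1 P2]]]] :=
  joint_approximation dX cX conX chX iX pt12 hpsi hg e0.
have [s1 [hs1 ts st]] := homeomorphism_inverse ht1.
exists (t1 \o h \o s1); split.
- exact: (homeomorphism_comp_fun (homeomorphism_comp_fun ht1 hh) hs1).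
- by move=> y /=; rewrite -{2}(st y).
- exists (t2 \o s1); first exact: (homeomorphism_comp_fun ht2 hs1).
  by move=> y /=; rewrite ts.
Qed.

(** Being nearly conjugate to [g] is stable under small uniform perturbations, so the limit of the
    later stages keeps what is achieved at this one. *)
Lemma conjugate_step (psi g : X -> X) (eta e : R) : homeomorphism psi -> 0 < eta ->
  homeomorphism g -> 0 < e -> exists psi' eta', [/\
    homeomorphism psi' /\ 0 < eta',
    forall x y, d (psi' x) y <= eta' -> d (psi x) y <= eta,
    forall x, exists2 U, nbhs x U & forall x' y y', U x' ->
      d (psi' x) y <= eta' -> d (psi' x') y' <= eta' -> d y y' < e,
    forall y, exists2 U, nbhs y U & forall y' x x', U y' ->
      d (psi' x) y <= eta' -> d (psi' x') y' <= eta' -> d x x' < e &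
    forall phi, (forall x, d (psi' x) (phi x) <= eta') ->
      nearly_conjugate phi g (2 * e)].
Proof.
move=> hpsi eta0 hg e0.
have e'0 : 0 < Num.min e (eta / 2) by minmax; lra.
have [psi' [hpsi' psi'psi [theta htheta thetaP]]] := push_conjugate hpsi hg e'0.
have [cpsi' _] := hpsi'; have [ctheta _] := htheta.
have [chi [[cchi _] psichi chipsi]] := homeomorphism_inverse hpsi'.
have [r r0 rP] := uniform_continuity_map dX cX cchi e0.
have [q q0 qP] := uniform_continuity_map dX cX ctheta e0.
(* In this order: nesting in the previous relation, small fibres, small fibres of the converse
   through the inverse of [psi'], and stability of near conjugacy through [theta]. *)
pose eta' := Num.min (Num.min (eta / 2) (e / 4)) (Num.min (r / 4) (q / 2)).
have eta'0 : 0 < eta' by rewrite /eta' !lt_min; lra.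
have eta'1 : eta' <= eta / 2 by rewrite /eta' !ge_min lexx.
have eta'2 : eta' <= e / 4 by rewrite /eta' !ge_min lexx !orbT.
have eta'3 : eta' <= r / 4 by rewrite /eta' !ge_min lexx !orbT.
have eta'4 : eta' <= q / 2 by rewrite /eta' !ge_min lexx !orbT.
clearbody eta'.
exists psi', eta'; split=> //.
- move=> x y xy; have : d (psi' x) (psi x) < eta / 2.
    by apply: lt_le_trans (psi'psi x) _; minmax; lra.
  have := dist_triangle dX (psi' x) (psi x) y.
  by rewrite (dist_sym dX (psi x) (psi' x)); lra.
- move=> x; exists (psi' @^-1` [set y | d (psi' x) y < eta']).
    by apply: cpsi'; exact: nbhs_dist.
  move=> x' y y' /= xx' xy xy'.
  have := dist_triangle dX (psi' x) y y'; have := dist_triangle dX (psi' x') (psi' x) y'.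
  by rewrite (dist_sym dX y (psi' x)); lra.
- move=> y; exists [set y' | d y y' < eta']; first exact: nbhs_dist.
  move=> y' x x' /= yy' xy xy'.
  have : d (psi' x) (psi' x') < r.
    have := dist_triangle dX y (psi' x) (psi' x'); have := dist_triangle dX y' y (psi' x').
    by rewrite (dist_sym dX y' (psi' x')); lra.
  by move=> /rP; rewrite !psichi.
- move=> phi phiP; exists theta => // y.
  have : d (theta (phi y)) (theta (psi' y)) < e.
    by apply: qP; rewrite dist_sym //; have := phiP y; lra.
  have : d (theta (psi' y)) (g (theta y)) < e.
    by apply: lt_le_trans (thetaP y) _; minmax; lra.
  by have := dist_triangle dX (theta (psi' y)) (theta (phi y)) (g (theta y)); lra.
Qed.

Lemma exists_universal_conjugate : exists2 phi : X -> X, homeomorphism phi &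
  forall g (e : R), homeomorphism g -> 0 < e -> nearly_conjugate phi g e.
Proof.
have [F [hF Fdense]] := countable_dense_homeomorphisms pt1.
pose S := {p : (X -> X) * R | homeomorphism p.1 /\ 0 < p.2}.
pose rel (p : S) x y := d ((sval p).1 x) y <= (sval p).2.
have r0 k : 0 < k.+1%:R^-1 :> R by rewrite invr_gt0.
have step (np : nat * S) : exists q : S, [/\
    forall x y, rel q x y -> rel np.2 x y,
    forall x, exists2 U, nbhs x U & forall x' y y', U x' ->
      rel q x y -> rel q x' y' -> d y y' < np.1.+1%:R^-1,
    forall y, exists2 U, nbhs y U & forall y' x x', U y' ->
      rel q x y -> rel q x' y' -> d x x' < np.1.+1%:R^-1 &
    forall phi, (forall x, rel q x (phi x)) ->
      nearly_conjugate phi (F (logn 2 np.1)) (2 * np.1.+1%:R^-1)].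
  have [h0 eta0] := svalP np.2.
  have [psi' [eta' [hp P1 P2 P3 P4]]] := conjugate_step h0 eta0 (hF (logn 2 np.1)) (r0 np.1).
  by exists (exist _ (psi', eta') hp); split.
have [G GP] := choice step.
have p0 : homeomorphism (@id X) /\ (0 : R) < 1 by split; [exact: homeomorphism_id|].
pose st := fix st n : S := if n is n'.+1 then G (n', st n') else exist _ (@id X, 1) p0.
have stS n : st n.+1 = G (n, st n) by [].
have [|||||||phi [hphi phiP]] := @limit_homeomorphism R X d dX cX (fun n => rel (st n)).
- by move=> n x y; rewrite stS; have [+ _ _ _] := GP (n, st n); exact.
- move=> n x; rewrite /rel; case: (st n) => -[psi eta] [/= hpsi eta0].
  by exists (psi x); rewrite dist_refl // ltW.
- move=> n y; rewrite /rel; case: (st n) => -[psi eta] [/= hpsi eta0].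
  have [chi [_ _ chipsi]] := homeomorphism_inverse hpsi.
  by exists (chi y); rewrite chipsi dist_refl // ltW.
- move=> n x; rewrite /rel; apply: closed_sublevel; exact: continuous_dist.
- move=> n y; rewrite /rel; case: (st n) => -[psi eta] [/= [cpsi _] eta0].
  rewrite (_ : [set x | _] = [set x | d y (psi x) <= eta]); last first.
    by apply/seteqP; split=> x /=; rewrite dist_sym.
  apply: (closed_sublevel eta (u := fun x => d y (psi x))) => x.
  by apply: continuous_comp; [exact: cpsi|exact: continuous_dist].
- move=> e /natSinv_small[n /(_ n (leqnn n)) ne]; exists n.+1 => x.
  have [_ /(_ x)[U xU UP] _ _] := GP (n, st n); exists U => // x' y y' Ux' h1 h2.
  exact: lt_trans (UP _ _ _ Ux' h1 h2) ne.
- move=> e /natSinv_small[n /(_ n (leqnn n)) ne]; exists n.+1 => y.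
  have [_ _ /(_ y)[U yU UP] _] := GP (n, st n); exists U => // y' x x' Uy' h1 h2.
  exact: lt_trans (UP _ _ _ Uy' h1 h2) ne.
exists phi => // g e hg e0.
have e2 : 0 < e / 2 by lra.
have e4 : 0 < e / 4 by lra.
have [i Fi] := Fdense g (e / 2) hg e2.
have [n nP] := natSinv_small e4.
(* [logn 2] takes every value infinitely often. *)
have [m nm mi] : exists2 m, (n <= m)%N & logn 2 m = i.
  exists ((n.*2.+1) * 2 ^ i)%N.
    by rewrite -[n in (n <= _)%N]muln1 leq_mul ?expn_gt0 //; lia.
  by rewrite logn_Gauss ?pfactorK // coprime2n /= odd_double.
have [_ _ _ /(_ phi)] := GP (m, st m); rewrite /= mi.
move=> [|theta htheta thetaP]; first by move=> x; rewrite -stS; exact: phiP.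
exists theta => // y; have := thetaP y; have := Fi (theta y); have := nP m nm.
have := dist_triangle dX (F i (theta y)) (theta (phi y)) (g (theta y)).
by move: (m.+1%:R^-1) => q; lra.
Qed.

End DenseConjugates.

(** Uniform balls around [f] form a filter base converging to [f] in the compact-open topology: on a
    compact [K] mapped into an open [V], one radius keeps all perturbed images in [V]. *)
Lemma Homeo_open_ball (R : realType) (X : topologicalType) (d : X -> X -> R)
    (O : set (Homeo X)) (f : Homeo X) : compatible_metric d -> open O -> O f ->
  exists2 e : R, 0 < e & forall g : Homeo X, (forall x, d (f x) (g x) < e) -> O g.
Proof.
move=> dX /open_set_typeP[C oC ->] Cf.
pose F := filter_from [set e : R | 0 < e]
  (fun e => [set g : {compact-open, X -> X} | forall x, d (f x) (g x) < e]).
have FF : Filter F.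
  apply: filter_from_filter; first by exists 1 => /=.
  move=> a b /= a0 b0; exists (Num.min a b); first by rewrite /=; minmax.
  by move=> g /= gab; split=> x; have := gab x; minmax; lra.
have cvF : F --> (set_val f : {compact-open, X -> X}).
  apply/compact_open_cvgP => K V cK oV fKV.
  pose P := [set S : set X | exists2 e : R, 0 < e &
    forall x z, S x -> d (f x) z < e -> V z].
  have [|A B [a a0 aP] [b b0 bP]|A B AB [b b0 bP]|x Kx|e e0 eP] := @compact_ind X K P cK.
  - by exists 1.
  - exists (Num.min a b); first by minmax.
    move=> x z [Ax|Bx] xz.
      by apply: (aP x) => //; move: xz; minmax; lra.
    by apply: (bP x) => //; move: xz; minmax; lra.
  - by exists b => // x z /AB; exact: bP.
  - have Vfx : V (f x) by apply: fKV; exists x.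
    have /(dist_nbhs dX)[e e0 eV] : nbhs (f x) V by exact: open_nbhs_nbhs.
    have e2 : 0 < e / 2 by lra.
    have [cf _] := homeoP f.
    exists (f @^-1` [set y | d (f x) y < e / 2]); first by apply: cf; exact: nbhs_dist.
    exists (e / 2) => // y z /= xy yz; apply: eV => /=.
    by have := dist_triangle dX (f y) (f x) z; lra.
  - exists e => // g /= ge _ [x Kx <-]; exact: (eP x).
have [e /= e0 eC] : F C by apply: cvF; exact: open_nbhs_nbhs.
by exists e => // g ge; exact: eC.
Qed.

Theorem theorem4p19 (R : realType) (X : topologicalType) (hX : pseudoarc R X) :
  exists phi : Homeo X, dense (conjugacy_class phi).
Proof.
have [[conX cX [d dX]] chX iX [pt1 [pt2 pt12]]] := hX.
have [phi hphi phiP] := exists_universal_conjugate dX cX conX chX iX pt12.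
exists (mk_homeo hphi) => O [f Of] oO.
have [e e0 eO] := Homeo_open_ball dX oO Of.
have [theta htheta thetaP] := phiP (homeo_fun f) e (homeoP f) e0.
pose T : Homeo X := mk_homeo htheta.
(* The conjugates close to [f] are theta o phi o theta^-1, whereas [conjugacy_class] has the inverse
   on the left; hence the conjugator is [T^-1]. *)
exists ((T^-1)^-1 * mk_homeo hphi * T^-1)%g; split; last by exists (T^-1)%g.
apply: eO => x; rewrite invgK !homeoM (dist_sym dX).
have [_ _ TV] := homeo_inv_funP T.
have := thetaP (homeo_inv_fun T x); rewrite -[theta]/(homeo_fun T) TV; exact.
Qed.
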